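(* Let $(n_k)_{k \in \mathbb{N}}$ be an enumeration of $\mathbb{Z}^d$, and let $(t_k)_{k \in \mathbb{N}} \subset \mathbb{R}^d$ be such that $$\sup_{k \in \mathbb{N}} \| n_k - t_k \|_\infty = L < \frac{\ln 2}{\pi d}.$$ Then the sequence $(f_k)_{k \in \mathbb{N}}$ defined by $f_k (x) = \frac{1}{(2\pi)^{d/2}}e^{i \langle x , t_k \rangle}$ is a Riesz basis for $L_2([-\pi,\pi]^d)$.
   Context: Given an orthonormal basis $(e_n)_n$ of a Hilbert space $H$, a sequence $(f_n)_n\subset H$ is a Riesz basis for $H$ if the map $Le_n = f_n$ is (extends to) an onto isomorphism $H\to H$. *)

(* Defs.v *)
From HB Require Import structures.
From mathcomp Require Import all_boot all_order all_algebra.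
From mathcomp Require Import sesquilinear generic_quotient ring_quotient.
From mathcomp Require Import complex.
From mathcomp Require Import all_classical all_reals all_analysis measurable_realfun.
From mathcomp Require Import ring.

Set Implicit Arguments.
Unset Strict Implicit.
Unset Printing Implicit Defensive.

Import Order.TTheory GRing.Theory Num.Theory.
Import numFieldNormedType.Exports.

Local Open Scope classical_set_scope.
Local Open Scope ring_scope.
Local Open Scope quotient_scope.

Local Notation Re := complex.Re.
Local Notation Im := complex.Im.
Local Notation normc := Normc.normc.

(* The product of two sigma-finite measures has a sigma-finiteness instance in
   the library, but it is shadowed by the one for finite measures and is not
   inferred; hence the explicit lemma below. *)
Section sigma_finite_lemmas.
Context d1 d2 (T1 : measurableType d1) (T2 : measurableType d2) (R : realType).

Lemma sigma_finite_pushforward (mu : set T1 -> \bar R)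
    (f : T1 -> T2) (g : T2 -> T1) :
  measurable_fun setT g -> cancel f g ->
  sigma_finite setT mu -> sigma_finite setT (pushforward mu f).
Proof.
move=> mg fK [F TF Foo]; exists (fun i => g @^-1` F i).
  by rewrite -preimage_bigcup -TF preimage_setT.
move=> i; have [mF Fi] := Foo i; split.
  by rewrite -[X in measurable X]setTI; exact: mg.
rewrite /pushforward -comp_preimage (_ : g \o f = id) ?preimage_id//.
by apply/funext => x /=; rewrite fK.
Qed.

Lemma sigma_finite_product (m1 : {sigma_finite_measure set T1 -> \bar R})
    (m2 : {sigma_finite_measure set T2 -> \bar R}) :
  sigma_finite setT (m1 \x m2)%E.
Proof.
have /sigma_finiteP[F [TF ndF Foo]] := sigma_finiteT m1.
have /sigma_finiteP[G [TG ndG Goo]] := sigma_finiteT m2.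
exists (fun n => F n `*` G n).
 rewrite -setXTT TF TG predeqE => -[x y]; split.
    move=> [/= [n _ Fnx] [k _ Gky]]; exists (maxn n k) => //; split.
    - by move: x Fnx; exact/subsetPset/ndF/leq_maxl.
    - by move: y Gky; exact/subsetPset/ndG/leq_maxr.
  by move=> [n _ []/= ? ?]; split; exists n.
move=> k; have [? ?] := Foo k; have [? ?] := Goo k.
split; first exact: measurableX.
by rewrite product_measure1E// lte_mul_pinfty// ge0_fin_numE.
Qed.

End sigma_finite_lemmas.

Section lebesgue_tuple.
Variable R : realType.
Local Notation T := (measurableTypeR R).

Definition cons_pair n (p : T * n.-tuple T) : n.+1.-tuple T :=
  [tuple of p.1 :: p.2].

Definition uncons_pair n (x : n.+1.-tuple T) : T * n.-tuple T :=
  (thead x, [tuple of behead x]).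

Lemma measurable_cons_pair n : measurable_fun setT (@cons_pair n).
Proof. exact: measurable_cons. Qed.

Lemma measurable_uncons_pair n : measurable_fun setT (@uncons_pair n).
Proof.
by apply/measurable_fun_pair;
  [exact: measurable_tnth | exact: measurable_behead].
Qed.

Lemma cons_pairK n : cancel (@cons_pair n) (@uncons_pair n).
Proof. by case=> x y; congr pair; apply/val_inj. Qed.

Section successor.
Variables (n : nat) (mu : {sigma_finite_measure set (n.-tuple T) -> \bar R}).

Definition lebesgue_cons : set (n.+1.-tuple T) -> \bar R :=
  pushforward (@lebesgue_measure R \x mu)%E (@cons_pair n).

Let nu : {measure set (n.+1.-tuple T) -> \bar R} :=
  measure_function_pushforward__canonical__measure_function_Measure
    (@lebesgue_measure R \x mu)%E (@measurable_cons_pair n).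

HB.instance Definition _ := isMeasure.Build _ _ _ lebesgue_cons
  (measure0 nu) (measure_ge0 nu) (@measure_semi_sigma_additive _ _ _ nu).

Lemma lebesgue_cons_sigma_finite : sigma_finite setT lebesgue_cons.
Proof.
apply: (sigma_finite_pushforward (@measurable_uncons_pair n)).
  exact: cons_pairK.
exact: sigma_finite_product.
Qed.

HB.instance Definition _ :=
  @Measure_isSigmaFinite.Build _ _ _ lebesgue_cons lebesgue_cons_sigma_finite.
End successor.

(* Lebesgue measure on R^n, with R^n = n.-tuple R and its product sigma-algebra:
   iterated product measure, transported along (x, y) |-> x :: y. *)
Fixpoint lebesgue_tuple n : {sigma_finite_measure set (n.-tuple T) -> \bar R} :=
  if n is m.+1 then lebesgue_cons (lebesgue_tuple m) else \d_[tuple].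

Definition cube n : set (n.-tuple T) :=
  [set x | forall i, - pi <= tnth x i <= pi].

Arguments cube : clear implicits.

Lemma measurable_cube n : measurable (cube n).
Proof.
rewrite (_ : cube n = \bigcap_(i in [set: 'I_n])
   ((fun x : n.-tuple T => tnth x i) @^-1` `[- pi, pi])); last first.
  apply/seteqP; split => x /= h i; first by move=> _ /=; rewrite in_itv/= h.
  by have := h i I; rewrite /= in_itv.
apply: fin_bigcap_measurable => // i _.
rewrite -[X in measurable X]setTI; apply: measurable_tnth => //.
Qed.

(* Lebesgue measure of R^n restricted to the cube. Integrating, or identifying
   functions a.e., with respect to it only looks at values in [-pi, pi]^n. *)
Definition cube_measure n : set (n.-tuple T) -> \bar R :=
  mrestr (lebesgue_tuple n) (@measurable_cube n).
Arguments cube_measure : clear implicits.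

HB.instance Definition _ n := Measure.on (cube_measure n).

Lemma cube_measureS n : lebesgue_tuple n.+1 (cube n.+1) =
  ((2 * pi)%:E * lebesgue_tuple n (cube n))%E.
Proof.
rewrite /= /lebesgue_cons /pushforward.
rewrite (_ : _ @^-1` _ = `[- pi, pi]%classic `*` cube n).
  rewrite product_measure1E//=; last exact: measurable_cube.
  by rewrite lebesgue_measure_itv/= lte_fin gtrN ?pi_gt0//= -EFinD opprK mulr2n mulrDl !mul1r.
apply/seteqP; split=> -[x y] /=.
  move=> h; split; first by rewrite /= in_itv/=; exact: (h ord0).
  by move=> i; have := h (lift ord0 i); rewrite tnthS.
rewrite in_itv/= => -[hx hy] i.
by case: (unliftP ord0 i) => [j ->|->]; rewrite ?tnthS ?tnth0.
Qed.

Lemma cube_measureE n : lebesgue_tuple n (cube n) = ((2 * pi) ^+ n)%:E.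
Proof.
elim: n => [|n ih]; last by rewrite cube_measureS ih -EFinM exprS.
by rewrite /= diracE mem_set// => -[].
Qed.

Lemma cube_measureT n : cube_measure n setT = ((2 * pi) ^+ n)%:E.
Proof. by rewrite /cube_measure/= /mrestr setTI cube_measureE. Qed.

Lemma cube_measure_fin n : fin_num_fun (cube_measure n).
Proof. by apply: lty_fin_num_fun; rewrite [X in (X < _)%E]cube_measureT ltry. Qed.

HB.instance Definition _ n :=
  @Measure_isFinite.Build _ _ _ (cube_measure n) (@cube_measure_fin n).
End lebesgue_tuple.
Arguments cube : clear implicits.
Arguments cube_measure : clear implicits.

Section L2fun.
Context d (T : measurableType d) (R : realType).
Variable mu : {measure set T -> \bar R}.
Local Notation C := R[i].

(* Measurability of a complex-valued function is that of its real and imaginary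
   parts; Normc.normc is the real-valued modulus. *)
Definition square_integrable (f : T -> C) : Prop :=
  [/\ measurable_fun setT (fun x => Re (f x)),
      measurable_fun setT (fun x => Im (f x)) &
      (\int[mu]_x (normc (f x) ^+ 2)%:E < +oo)%E].

Lemma normc_sqr (z : C) : normc z ^+ 2 = Re z ^+ 2 + Im z ^+ 2.
Proof. by case: z => a b; rewrite /normc sqr_sqrtr// addr_ge0 ?sqr_ge0. Qed.

Lemma Lfun2P (f : T -> R) : measurable_fun setT f ->
  f \in Lfun mu 2%:E <-> (\int[mu]_x (f x ^+ 2)%:E < +oo)%E.
Proof.
move=> mf; have E : (\int[mu]_x (f x ^+ 2)%:E = \int[mu]_x `|(EFin \o f) x| `^ 2)%E.
  by apply: eq_integral => x _ /=; rewrite powR_mulrn// real_normK ?num_real.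
rewrite E -poweR_Lnorm//; split => [|h].
  by rewrite inE => /andP[_]; rewrite inE/= => h; exact: poweR_lty.
rewrite inE; apply/andP; split; rewrite inE//= /finite_norm.
by apply: (lty_poweRy _ h).
Qed.

Lemma square_integrableP (f : T -> C) : square_integrable f <->
  (fun x => Re (f x)) \in Lfun mu 2%:E /\ (fun x => Im (f x)) \in Lfun mu 2%:E.
Proof.
split=> [[mr mi fi]|[fr fi]].
  split; apply/Lfun2P => //; apply: le_lt_trans fi;
   (apply: ge0_le_integral => //; [
    by move=> x _; rewrite lee_fin sqr_ge0 |
    by apply/measurable_EFinP; exact: measurable_funX |
    under eq_fun do rewrite normc_sqr; apply/measurable_EFinP;
    by apply: measurable_funD; exact: measurable_funX |
    by move=> x _; rewrite lee_fin normc_sqr ?lerDl ?lerDr sqr_ge0]).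
have mr : measurable_fun setT (fun x => Re (f x)).
  by case/andP: fr => [/set_mem].
have mi : measurable_fun setT (fun x => Im (f x)).
  by case/andP: fi => [/set_mem].
split => //; under eq_integral do rewrite normc_sqr EFinD.
rewrite ge0_integralD//=; first by apply: lte_add_pinfty; apply/Lfun2P.
- by move=> x _; rewrite lee_fin sqr_ge0.
- by apply/measurable_EFinP; exact: measurable_funX.
- by move=> x _; rewrite lee_fin sqr_ge0.
- by apply/measurable_EFinP; exact: measurable_funX.
Qed.

Definition sqint : {pred T -> C} := mem [set f | square_integrable f].

Lemma sqintP f : reflect (square_integrable f) (f \in sqint).
Proof. exact: (iffP idP) set_mem mem_set. Qed.

Lemma sqint_submod_closed : submod_closed sqint.
Proof.
have cl := Lfun_submod_closed mu (lee1n 2).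
split.
  apply/sqintP/square_integrableP; split; exact: cl.1.
move=> a f g /sqintP/square_integrableP[fr fi] /sqintP/square_integrableP[gr gi].
apply/sqintP/square_integrableP; split.
- rewrite (_ : (fun x => _) = (Re a *: (fun x => Re (f x)) +
    ((- Im a) *: (fun x => Im (f x)) + (fun x => Re (g x))) : T -> R)).
    by apply: cl.2 => //; exact: cl.2.
  apply/funext => x; rewrite /GRing.scale/= !fctE/=.
  by case: a (f x) (g x) => [a b] [u v] [s t] /=; rewrite /GRing.scale/=; ring.
- rewrite (_ : (fun x => _) = (Re a *: (fun x => Im (f x)) +
    ((Im a) *: (fun x => Re (f x)) + (fun x => Im (g x))) : T -> R)).
    by apply: cl.2 => //; exact: cl.2.
  apply/funext => x; rewrite /GRing.scale/= !fctE/=.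
  by case: a (f x) (g x) => [a b] [u v] [s t] /=; rewrite /GRing.scale/=; ring.
Qed.

HB.instance Definition _ :=
  GRing.isSubmodClosed.Build C (T -> C) sqint sqint_submod_closed.

Record L2fun := MkL2fun { L2fun_val :> T -> C; _ : L2fun_val \in sqint }.

HB.instance Definition _ := [isSub for L2fun_val].
HB.instance Definition _ := [Choice of L2fun by <:].
HB.instance Definition _ := [SubChoice_isSubLmodule of L2fun by <:].

Lemma L2funDE (f g : L2fun) x : (f + g) x = f x + g x. Proof. by []. Qed.
Lemma L2funZE a (f : L2fun) x : (a *: f) x = a * f x. Proof. by []. Qed.

Lemma L2funP (f : L2fun) : square_integrable f.
Proof. by case: f => f /= /sqintP. Qed.

Definition null_L2fun : {pred L2fun} :=
  mem [set f : L2fun | {ae mu, forall x, f x = 0}].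

Lemma null_L2funP (f : L2fun) :
  reflect {ae mu, forall x, f x = 0} (f \in null_L2fun).
Proof. exact: (iffP idP) set_mem mem_set. Qed.

Lemma null_L2fun_submod_closed : submod_closed null_L2fun.
Proof.
split; first by apply/null_L2funP; exact: aeW.
move=> a f g /null_L2funP f0 /null_L2funP g0; apply/null_L2funP.
by apply: filterS2 f0 g0 => x fx gx /=; rewrite !fctE/= fx gx scaler0 addr0.
Qed.

HB.instance Definition _ :=
  GRing.isSubmodClosed.Build C L2fun null_L2fun null_L2fun_submod_closed.

(* L_2(mu), complex-valued: square-integrable functions modulo the submodule of
   those vanishing mu-almost everywhere. *)
Definition L2 : Type := Quotient.quot null_L2fun.
HB.instance Definition _ := GRing.Zmodule.on L2.
HB.instance Definition _ := EqQuotient.on L2.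

Definition L2class (f : L2fun) : L2 := \pi_L2 f.

Lemma L2class_eq (f g : L2fun) :
  L2class f = L2class g <-> {ae mu, forall x, f x = g x}.
Proof.
split.
  move/eqP; rewrite /L2class -Quotient.idealrBE => /null_L2funP.
  by apply: filterS => x /=; rewrite !fctE => /eqP; rewrite subr_eq0 => /eqP.
move=> h; apply/eqP; rewrite -Quotient.idealrBE; apply/null_L2funP.
by apply: filterS h => x fg /=; rewrite !fctE fg subrr.
Qed.


Definition L2scale (a : C) (u : L2) : L2 := L2class (a *: repr u).

Lemma L2classK (u : L2) : L2class (repr u) = u. Proof. exact: reprK. Qed.

Lemma L2classD (f g : L2fun) : L2class (f + g) = L2class f + L2class g.
Proof. by rewrite /L2class !piE. Qed.

Lemma L2class_scale a (f : L2fun) : L2class (a *: f) = L2scale a (L2class f).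
Proof.
apply/L2class_eq; have /L2class_eq := L2classK (L2class f).
by apply: filterS => x fx; rewrite !L2funZE fx.
Qed.

Fact L2scaleA a b u : L2scale a (L2scale b u) = L2scale (a * b) u.
Proof. by rewrite -[u]L2classK -!L2class_scale scalerA. Qed.
Fact L2scale1 : left_id 1 L2scale.
Proof. by move=> u; rewrite -[u]L2classK -!L2class_scale scale1r. Qed.
Fact L2scaleDr : right_distributive L2scale +%R.
Proof.
move=> a u v; rewrite -[u]L2classK -[v]L2classK -L2classD -!L2class_scale.
by rewrite scalerDr L2classD.
Qed.
Fact L2scaleDl u : {morph L2scale^~ u : a b / a + b}.
Proof.
by move=> a b; rewrite -[u]L2classK -!L2class_scale scalerDl L2classD.
Qed.
HB.instance Definition _ := GRing.Zmodule_isLmodule.Build C L2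
  L2scaleA L2scale1 L2scaleDr L2scaleDl.

Lemma L2classZ a (f : L2fun) : L2class (a *: f) = a *: L2class f.
Proof. exact: L2class_scale. Qed.

Lemma L2class0 : L2class 0 = 0.
Proof. by rewrite -[X in L2class X](scale0r (0 : L2fun)) L2classZ scale0r. Qed.

Definition cintegral (h : T -> C) : C :=
  Complex (\int[mu]_x Re (h x)) (\int[mu]_x Im (h x)).

Definition L2fun_dot (f g : L2fun) : C := cintegral (fun x => f x * conjc (g x)).

(* <u, v> = int u(x) * conj (v(x)) dmu(x) *)
Definition L2dot (u v : L2) : C := L2fun_dot (repr u) (repr v).

Let L2funRI (f : L2fun) := iffLR (square_integrableP f) (L2funP f).

Let intRR (f g : T -> R) : f \in Lfun mu 2%:E -> g \in Lfun mu 2%:E ->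
  mu.-integrable setT (fun x => (f x * g x)%:E).
Proof. by move=> fl gl; apply/Lfun1_integrable/Lfun2_mul_Lfun1. Qed.

Let integrable_Re (f g : L2fun) :
  mu.-integrable setT (fun x => (Re (f x * conjc (g x)))%:E).
Proof.
rewrite (_ : (fun x => _) = (fun x => (Re (f x) * Re (g x))%:E
    + (Im (f x) * Im (g x))%:E)%E); last first.
  by apply/funext => x; rewrite -EFinD; congr EFin;
     case: (f x) (g x) => [a b] [u v] /=; ring.
by apply: integrableD => //; apply: intRR; case: (L2funRI f) (L2funRI g) => ? ? [].
Qed.

Let integrable_Im (f g : L2fun) :
  mu.-integrable setT (fun x => (Im (f x * conjc (g x)))%:E).
Proof.
rewrite (_ : (fun x => _) = (fun x => (Im (f x) * Re (g x))%:E
    - (Re (f x) * Im (g x))%:E)%E); last first.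
  by apply/funext => x; rewrite -EFinB; congr EFin;
     case: (f x) (g x) => [a b] [u v] /=; ring.
by apply: integrableB => //; apply: intRR; case: (L2funRI f) (L2funRI g) => ? ? [].
Qed.

Let addcE (a b c e : R) : Complex a b + Complex c e = Complex (a + c) (b + e).
Proof. by []. Qed.
Let mulcE (a b c e : R) : Complex a b * Complex c e =
  Complex (a * c - b * e) (a * e + b * c).
Proof. by []. Qed.

Lemma L2fun_dotC f g : L2fun_dot f g = conjc (L2fun_dot g f).
Proof.
rewrite /L2fun_dot /cintegral/=; congr Complex.
  apply: eq_Rintegral => x _.
  by case: (f x) (g x) => [a b] [u v] /=; ring.
rewrite -mulN1r -(RintegralZl _ measurableT (integrable_Im g f)).
apply: eq_Rintegral => x _.
by case: (f x) (g x) => [a b] [u v] /=; ring.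
Qed.

Lemma L2fun_dotDl (f g h : L2fun) : L2fun_dot (f + g) h = L2fun_dot f h + L2fun_dot g h.
Proof.
rewrite /L2fun_dot /cintegral addcE; congr Complex.
  rewrite -(RintegralD measurableT (integrable_Re f h) (integrable_Re g h)).
  apply: eq_Rintegral => x _; rewrite L2funDE.
  by case: (f x) (g x) (h x) => [a b] [u v] [s t]/=; ring.
rewrite -(RintegralD measurableT (integrable_Im f h) (integrable_Im g h)).
apply: eq_Rintegral => x _; rewrite L2funDE.
by case: (f x) (g x) (h x) => [a b] [u v] [s t]/=; ring.
Qed.

Lemma L2fun_dotZl a (f h : L2fun) : L2fun_dot (a *: f) h = a * L2fun_dot f h.
Proof.
case: a => p q; rewrite /L2fun_dot /cintegral mulcE.
have IR := integrable_Re f h; have II := integrable_Im f h.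
have ZR r := integrableZl measurableT r IR.
have ZI r := integrableZl measurableT r II.
congr Complex.
  rewrite -(RintegralZl p measurableT IR) -(RintegralZl q measurableT II).
  rewrite -(RintegralB measurableT (ZR p) (ZI q)).
  apply: eq_Rintegral => x _; rewrite L2funZE.
  by case: (f x) (h x) => [u v] [s t]/=; ring.
rewrite -(RintegralZl p measurableT II) -(RintegralZl q measurableT IR).
rewrite -(RintegralD measurableT (ZI p) (ZR q)).
apply: eq_Rintegral => x _; rewrite L2funZE.
by case: (f x) (h x) => [u v] [s t]/=; ring.
Qed.

Lemma L2fun_dot_null (f g : L2fun) : {ae mu, forall x, f x = 0} -> L2fun_dot f g = 0.
Proof.
move=> f0; rewrite /L2fun_dot /cintegral; apply/eqP; rewrite eq_complex/=.
have IR := integrable_Re f g; have II := integrable_Im f g.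
apply/andP; split; apply/eqP; rewrite /Rintegral.
  rewrite (_ : (\int[mu]_x _ = 0)%E)//.
  rewrite (ae_eq_integral (cst 0%E)) ?integral0//.
  - exact: measurable_int IR.
  - by apply: filterS f0 => x /= fx _; rewrite fx mul0r.
rewrite (_ : (\int[mu]_x _ = 0)%E)//.
rewrite (ae_eq_integral (cst 0%E)) ?integral0//.
- exact: measurable_int II.
- by apply: filterS f0 => x /= fx _; rewrite fx mul0r.
Qed.

Lemma L2fun_dot_eql (f f' g : L2fun) : L2class f = L2class f' ->
  L2fun_dot f g = L2fun_dot f' g.
Proof.
move=> /L2class_eq ff'; rewrite -[f](subrK f') L2fun_dotDl.
rewrite L2fun_dot_null ?add0r//.
by apply: filterS ff' => x fx; rewrite L2funDE fx -L2funDE subrr.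
Qed.

Lemma L2dotE f g : L2dot (L2class f) (L2class g) = L2fun_dot f g.
Proof.
rewrite /L2dot (L2fun_dot_eql _ (L2classK (L2class f))).
by rewrite L2fun_dotC (L2fun_dot_eql _ (L2classK (L2class g))) -L2fun_dotC.
Qed.

Fact L2dotC u v : L2dot u v = (-1) ^+ false * Num.conj (L2dot v u).
Proof. by rewrite expr0 mul1r /L2dot L2fun_dotC. Qed.

Fact L2dot_linearl v : linear_for *%R (L2dot^~ v).
Proof.
move=> a u w; rewrite -[u]L2classK -[w]L2classK -[v]L2classK.
by rewrite -L2classZ -L2classD !L2dotE L2fun_dotDl L2fun_dotZl.
Qed.

Fact L2dot_linearr u : linear_for (Num.conj \; *%R) (L2dot u).
Proof.
move=> a v w /=; rewrite [LHS]L2dotC expr0 mul1r L2dot_linearl rmorphD rmorphM.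
by rewrite [in RHS]L2dotC (L2dotC u w) !expr0 !mul1r.
Qed.

HB.instance Definition _ := bilinear_isBilinear.Build C L2 L2 C *%R
  (Num.conj \; *%R) L2dot (L2dot_linearl, L2dot_linearr).
HB.instance Definition _ := isHermitianSesquilinear.Build C L2 false Num.conj
  L2dot L2dotC.

Lemma L2fun_dotff f : L2fun_dot f f = Complex (\int[mu]_x (normc (f x) ^+ 2)) 0.
Proof.
rewrite /L2fun_dot /cintegral; congr Complex.
  apply: eq_Rintegral => x _; rewrite normc_sqr.
  by case: (f x) => a b /=; ring.
rewrite (_ : (fun x => _) = cst 0); first by rewrite /Rintegral integral0.
by apply/funext => x/=; case: (f x) => a b /=; ring.
Qed.

Fact L2dot_gt0 u : u != 0 -> 0 < L2dot u u.
Proof.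
rewrite -[u]L2classK; move: (repr u) => f; rewrite L2dotE L2fun_dotff => f0.
rewrite ltcE/= eqxx/= lt_neqAle Rintegral_ge0; last first.
  by move=> x _; exact: sqr_ge0.
rewrite andbT; apply: contraNneq f0 => /esym f0.
suff -> : L2class f = L2class 0 by rewrite L2class0.
apply/L2class_eq; have [mr mi fi] := L2funP f.
have mn : measurable_fun setT (fun x => (normc (f x) ^+ 2)%:E).
  apply/measurable_EFinP; under eq_fun do rewrite normc_sqr.
  by apply: measurable_funD; exact: measurable_funX.
have n0 x : (0 <= (normc (f x) ^+ 2)%:E)%E by rewrite lee_fin sqr_ge0.
have : (\int[mu]_x `|(normc (f x) ^+ 2)%:E| = 0)%E.
  under eq_integral do rewrite gee0_abs//.
  rewrite -[LHS]fineK; first by rewrite [X in X%:E]f0.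
  by rewrite ge0_fin_numE// integral_ge0.
move/(ae_eq_integral_abs mu measurableT mn).
apply: filterS => x /(_ I)/= /eqP; rewrite eqe sqrf_eq0 => /eqP.
exact: Normc.eq0_normc.
Qed.

HB.instance Definition _ := isDotProduct.Build C L2 L2dot L2dot_gt0.

End L2fun.

Arguments L2 {d T R} mu.
Arguments L2class {d T R} mu f.
Arguments L2dot {d T R} mu u v.

(* The inner product [dot] is linear in the first argument. Completeness of H is
   not needed to state these definitions. *)
Section riesz_basis.
Variables (R : realType) (H : lmodType R[i]) (dot : {dot H for Num.conj}).

Definition hnorm (u : H) : R := Num.sqrt (Re (dot u u)).

(* Orthonormal with dense linear span. *)
Definition orthonormal_basis (e : nat -> H) : Prop :=
  (forall m n, dot (e m) (e n) = (m == n)%:R) /\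
  (forall (u : H) (eps : R), 0 < eps ->
     exists (n : nat) (c : 'I_n -> R[i]),
       hnorm (u - \sum_(k < n) c k *: e k) < eps).

Definition bounded_operator (A : {linear H -> H}) : Prop :=
  exists M : R, forall u, hnorm (A u) <= M * hnorm u.

(* Bounded linear bijection H -> H with bounded linear inverse. *)
Definition onto_isomorphism (A : {linear H -> H}) : Prop :=
  bounded_operator A /\
  exists B : {linear H -> H},
    [/\ bounded_operator B, cancel A B & cancel B A].

Definition riesz_basis (f : nat -> H) : Prop :=
  exists2 e : nat -> H, orthonormal_basis e &
  exists2 A : {linear H -> H}, onto_isomorphism A & forall k, A (e k) = f k.

End riesz_basis.

Section exponentials.
Context {R : realType} {n : nat}.
Local Notation T := (measurableTypeR R).
Implicit Types x t : n.-tuple T.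

Definition dotp x t : R := \sum_(i < n) tnth x i * tnth t i.

Definition linf_dist x t : R :=
  \big[Num.max/0]_(i < n) `|tnth x i - tnth t i|.

(* e^{i a} for real a *)
Definition expi (a : R) : R[i] := Complex (cos a) (sin a).

(* (2 pi)^{-n/2} e^{i <x, t>} *)
Definition exp_fun t x : R[i] :=
  real_complex R ((2 * pi) `^ (n%:R / 2))^-1 * expi (dotp x t).

Lemma measurable_dotp t : measurable_fun setT (dotp ^~ t).
Proof.
apply: measurable_sum => i; apply: measurable_funM => //.
exact: measurable_tnth.
Qed.

Lemma exp_fun_square_integrable t :
  square_integrable (cube_measure R n) (exp_fun t).
Proof.
have E x : exp_fun t x = Complex (((2 * pi) `^ (n%:R / 2))^-1 * cos (dotp x t))
   (((2 * pi) `^ (n%:R / 2))^-1 * sin (dotp x t)).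
  by rewrite /exp_fun /expi; congr Complex => /=; ring.
split.
- under eq_fun do rewrite E/=; apply: measurable_funM => //.
  apply: measurableT_comp (measurable_dotp t).
  exact: continuous_measurable_fun (@continuous_cos R).
- under eq_fun do rewrite E/=; apply: measurable_funM => //.
  apply: measurableT_comp (measurable_dotp t).
  exact: continuous_measurable_fun (@continuous_sin R).
- under eq_integral => x _.
    rewrite E normc_sqr/= !exprMn -mulrDr cos2Dsin2 mulr1.
    over.
  rewrite integral_cst// [X in (_ * X)%E]cube_measureT -EFinM.
  exact: ltry.
Qed.

Definition exp_L2fun t : L2fun (cube_measure R n) :=
  MkL2fun (introT (sqintP _ _) (exp_fun_square_integrable t)).

Definition exp_L2 t : L2 (cube_measure R n) := L2class _ (exp_L2fun t).

End exponentials.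

(* Main.v *)
(** The system [e_k(x) = (2 pi)^(-d/2) exp(i <x, n_k>)] is an orthonormal basis,
    and [f_k = exp(i <x, t_k - n_k>) e_k] is a small perturbation of it: expanding
    the exponential, [sum_k c_k (f_k - e_k) = sum_(p >= 1) U_p c] with
    [U_p c = sum_k c_k (i <x, t_k - n_k>)^p / p! e_k].  Peeling off one factor
    [<x, t_k - n_k> = sum_j x_j (t_k - n_k)_j] expresses [U_(p+1)] through the
    multiplications by [x_j] (of norm at most [pi]) and the diagonal operators
    [(t_k - n_k)_j] (of norm at most [L]), so [|U_p| <= (d pi L)^p / p!].  Hence the
    perturbation has norm at most [exp (d pi L) - 1 < 1], and the operator
    [e_k |-> f_k] is inverted by a Neumann series.

    Completeness of the trigonometric system: if an integrable [p] has
    vanishing cosine coefficients, then multiplication by [cos (x_j - a)], followed by bounded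
    pointwise limits, shows that so does [p 1_E] for every half-space
    [cos (x_j - a) < 0], hence for every measurable [E]. *)

Require Import Defs.
From HB Require Import structures.
From mathcomp Require Import all_boot all_order all_algebra.
From mathcomp Require Import sesquilinear complex.
From mathcomp Require Import all_classical all_reals all_analysis.
From mathcomp Require Import measurable_realfun.
From mathcomp Require Import ring lra.

Import Order.TTheory GRing.Theory Num.Theory.
Import numFieldNormedType.Exports.
Local Open Scope classical_set_scope.
Local Open Scope ring_scope.

Set Implicit Arguments.
Unset Strict Implicit.
Unset Printing Implicit Defensive.

Local Notation Re := complex.Re.
Local Notation Im := complex.Im.
Local Notation normc := Normc.normc.

(** * Hilbert spaces and Paley-Wiener perturbations *)

(** [U_p] never appears as an operator on the whole space. Every estimate concerns a finite block
    [a <= k < b] of coefficients, so summations are interchanged only for finite sums, and the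
    Taylor limit, known pointwise in [x], reaches the norm through Fatou's lemma. Bounds on all
    blocks, not only on initial ones, make the perturbed series Cauchy; completeness of L_2 then
    yields the operator. The phase [<x, t_k - n_k>] depends on [x] and on [k] together, so it is
    neither a multiplication nor a diagonal operator; only its summands [x_j (t_k - n_k)_j] factor
    into one of each. The diagonal factor changes the coefficients, which is why the induction on
    [p] must run over all coefficient sequences at once. For [d > 0] the bound on [L] says exactly
    [d pi L < ln 2], that is [exp (d pi L) < 2]. In the completeness argument, a cosine of one
    coordinate is the convenient multiplier because it merely shifts frequencies by one, and the
    half-spaces suffice because, on the open cube, sign conditions on shifted sines recover every
    set [x_j < b]. *)

Section normc.
Context (R : rcfType).
Implicit Types a b : R[i].

Lemma normc_ge0 a : 0 <= normc a.
Proof. by case: a => x y; exact: sqrtr_ge0. Qed.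

Lemma normc_real_complex (x : R) : normc (real_complex R x) = `|x|.
Proof. by rewrite /= expr0n addr0 sqrtr_sqr. Qed.

Lemma normcM a b : normc (a * b) = normc a * normc b.
Proof. exact: Normc.normcM. Qed.

Lemma normcN a : normc (- a) = normc a.
Proof. by case: a => x y /=; rewrite !sqrrN. Qed.
End normc.

Section hilbert.
Context (R : realType) (H : lmodType R[i]) (dot : {dot H for Num.conj}).
Local Notation hnorm := (hnorm dot).
Implicit Types (u v w : H) (a : R[i]).

Lemma hnorm_ge0 u : 0 <= hnorm u.
Proof. exact: sqrtr_ge0. Qed.

Lemma sqr_hnorm u : hnorm u ^+ 2 = Re (dot u u).
Proof.
rewrite sqr_sqrtr//; have := dnorm_ge0 dot u.
by case: (dot u u) => x y; rewrite lecE/= => /andP[].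
Qed.

Lemma dotuu u : dot u u = Complex (hnorm u ^+ 2) 0.
Proof.
rewrite sqr_hnorm; have := dnorm_ge0 dot u.
by case: (dot u u) => x y; rewrite lecE/= => /andP[/eqP ->].
Qed.

Lemma dotC u v : dot u v = conjc (dot v u).
Proof. by rewrite hermC expr0 mul1r. Qed.

Lemma hnorm0_eq0 u : hnorm u = 0 -> u = 0.
Proof.
move=> u0; apply/eqP; rewrite -(dnorm_eq0 dot) dotuu u0 expr0n/=.
exact: eqxx.
Qed.

Lemma dotDl u v w : dot (u + v) w = dot u w + dot v w.
Proof. exact: linearDl. Qed.

Lemma dotDr u v w : dot u (v + w) = dot u v + dot u w.
Proof. exact: linearDr. Qed.

Lemma dotZl a u v : dot (a *: u) v = a * dot u v.
Proof. exact: linearZl_LR. Qed.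

Lemma dotZr a u v : dot u (a *: v) = conjc a * dot u v.
Proof. exact: linearZr_LR. Qed.

Lemma dotBl u v w : dot (u - v) w = dot u w - dot v w.
Proof. exact: linearBl. Qed.

Lemma dot_suml (I : Type) (r : seq I) (P : pred I) (F : I -> H) v :
  dot (\sum_(i <- r | P i) F i) v = \sum_(i <- r | P i) dot (F i) v.
Proof. exact: linear_sumlz. Qed.

Lemma dot0l u : dot 0 u = 0.
Proof. exact: linear0l. Qed.

Lemma hnorm0 : hnorm 0 = 0.
Proof. by rewrite /Defs.hnorm dot0l sqrtr0. Qed.

Lemma sqr_hnormD u v :
  hnorm (u + v) ^+ 2 = hnorm u ^+ 2 + hnorm v ^+ 2 + 2 * Re (dot u v).
Proof.
rewrite !sqr_hnorm dotDl !dotDr (dotC v u).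
by case: (dot u u) (dot v v) (dot u v) => [? ?] [? ?] [? ?] /=; ring.
Qed.

Lemma hnormZ a u : hnorm (a *: u) = normc a * hnorm u.
Proof.
apply/eqP; rewrite -(@eqrXn2 _ 2) ?hnorm_ge0 ?mulr_ge0 ?hnorm_ge0 ?sqrtr_ge0//; last first.
  by case: a => x y; rewrite sqrtr_ge0.
rewrite exprMn normc_sqr !sqr_hnorm dotZl dotZr dotuu.
by case: a => x y /=; apply/eqP; ring.
Qed.

Lemma hnormN u : hnorm (- u) = hnorm u.
Proof.
rewrite -scaleN1r hnormZ normcN.
by rewrite (normc_real_complex 1) normr1 mul1r.
Qed.

Lemma hnormBC u v : hnorm (u - v) = hnorm (v - u).
Proof. by rewrite -hnormN opprB. Qed.

Lemma Re_dot_le u v : Re (dot u v) <= hnorm u * hnorm v.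
Proof.
have [/eqP|uv0] := eqVneq (hnorm u * hnorm v) 0.
  rewrite mulf_eq0 => /orP[] /eqP h; rewrite h ?mul0r ?mulr0.
    by rewrite (hnorm0_eq0 h) dot0l.
  by rewrite dotC (hnorm0_eq0 h) dot0l.
have uvp : 0 < hnorm u * hnorm v by rewrite lt_def uv0 mulr_ge0 ?hnorm_ge0.
(* With [a = |u|], [b = |v|] and [x = Re <u, v>], the squared norm of [b u - a v] is
   [2 a b (a b - x)]. *)
have := sqr_ge0 (hnorm (real_complex R (hnorm v) *: u
   + - real_complex R (hnorm u) *: v)).
rewrite sqr_hnormD !hnormZ normcN !normc_real_complex.
rewrite !ger0_norm ?hnorm_ge0// dotZl dotZr.
move: (dot u v) => [x y]/=; move: uvp; set a := hnorm u; set b := hnorm v.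
move=> uvp h; have {h} : 0 <= 2 * (a * b) * (a * b - x) by lra.
by rewrite pmulr_rge0 ?subr_ge0// mulr_gt0.
Qed.

Lemma ler_hnormD u v : hnorm (u + v) <= hnorm u + hnorm v.
Proof.
rewrite -(@ler_pXn2r _ 2)// ?nnegrE ?hnorm_ge0 ?addr_ge0 ?hnorm_ge0//.
have h := Re_dot_le u v.
by rewrite sqr_hnormD sqrrD; lra.
Qed.

Lemma ler_hnorm_sum (I : Type) (r : seq I) (F : I -> H) :
  hnorm (\sum_(i <- r) F i) <= \sum_(i <- r) hnorm (F i).
Proof.
elim/big_ind2 : _ => [|x y z w h1 h2|//]; first by rewrite hnorm0.
by rewrite (le_trans (ler_hnormD _ _))// lerD.
Qed.

Lemma ler_hnormB_trans v u w : hnorm (u - w) <= hnorm (u - v) + hnorm (v - w).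
Proof. by rewrite -[u - w](subrKA v) ler_hnormD. Qed.

(** [H] is a bare module without topology, so convergence is that of the real sequence of
    distances. *)
Definition hcvg (x : nat -> H) (l : H) := hnorm (x n - l) @[n --> \oo] --> (0 : R).

Definition hcauchy (x : nat -> H) := forall eps : R, 0 < eps ->
  exists N, forall m n, (N <= m)%N -> (N <= n)%N -> hnorm (x m - x n) < eps.

Definition hcomplete := forall x, hcauchy x -> exists l, hcvg x l.

Lemma hcvg_squeeze x l (b : nat -> R) :
  (forall n, hnorm (x n - l) <= b n) -> b n @[n --> \oo] --> (0 : R) -> hcvg x l.
Proof.
move=> xb b0; apply: (squeeze_cvgr _ _ b0); last exact: cvg_cst.
by near=> n; rewrite hnorm_ge0 xb.
Unshelve. all: by end_near. Qed.

Lemma hcvgD x y l m : hcvg x l -> hcvg y m -> hcvg (fun n => x n + y n) (l + m).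
Proof.
move=> xl ym; apply: (hcvg_squeeze (b := fun n => hnorm (x n - l) + hnorm (y n - m))).
  by move=> n; rewrite opprD addrACA ler_hnormD.
by rewrite -[0]addr0; exact: cvgD.
Qed.

Lemma hcvgZ a x l : hcvg x l -> hcvg (fun n => a *: x n) (a *: l).
Proof.
move=> xl; apply: (hcvg_squeeze (b := fun n => normc a * hnorm (x n - l))).
  by move=> n; rewrite -scalerBr hnormZ.
by rewrite -(mulr0 (normc a)); exact: cvgMr.
Qed.

Lemma hcvg_shift k x l : hcvg x l -> hcvg (fun n => x (n + k)%N) l.
Proof. by move=> xl; rewrite /hcvg (cvg_shiftn k (fun n => hnorm (x n - l))). Qed.

Lemma hcvg_norm_le x l (b : R) : hcvg x l -> (\forall n \near \oo, hnorm (x n) <= b) ->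
  hnorm l <= b.
Proof.
move=> xl xb; rewrite -[b]addr0.
have h1 : hnorm l @[_ --> \oo] --> hnorm l by exact: cvg_cst.
have h2 : b + hnorm (x n - l) @[n --> \oo] --> b + 0.
  by apply: cvgD => //; exact: cvg_cst.
apply: (ler_cvg_to h1 h2).
apply: filterS xb => n xb; rewrite -[X in hnorm X](subrK (x n)) addrC.
by rewrite (le_trans (ler_hnormD _ _))// lerD// hnormBC.
Qed.

Lemma hcvg_unique x l m : hcvg x l -> hcvg x m -> l = m.
Proof.
move=> xl xm; apply/eqP; rewrite -subr_eq0; apply/eqP/hnorm0_eq0/eqP.
rewrite eq_le hnorm_ge0 andbT.
have := hcvgD xl (hcvgZ (-1) xm); rewrite scaleN1r => /hcvg_norm_le; apply.
by apply: nearW => n; rewrite scaleN1r subrr hnorm0.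
Qed.

(** The left-hand sides are squares, so [b] is nondecreasing; being bounded it converges, and its
    increments become uniformly small. For orthogonal series [b] is the partial sum of the squared
    coefficients. *)
Lemma hcauchy_dom x (b : R^nat) :
  (forall m n, (m <= n)%N -> hnorm (x n - x m) ^+ 2 <= b n - b m) ->
  (exists M, forall n, b n <= M) -> hcauchy x.
Proof.
move=> xb [M bM] e e0.
have ndb : nondecreasing_seq b.
  by move=> m n mn; rewrite -subr_ge0 (le_trans _ (xb _ _ mn))// sqr_ge0.
have cb : cvgn b by apply: nondecreasing_is_cvgn => //; exists M => _ [n _ <-].
have /cvgrPdist_lt/(_ (e ^+ 2)) := cb.
rewrite exprn_gt0// => /(_ isT)[N _ Nb]; exists N.
have key m n : (N <= m)%N -> (m <= n)%N -> hnorm (x n - x m) < e.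
  move=> Nm mn; rewrite -(@ltr_pXn2r _ 2)// ?nnegrE ?hnorm_ge0 ?ltW//.
  rewrite (le_lt_trans (xb _ _ mn))// (le_lt_trans _ (Nb _ Nm))//.
  rewrite (le_trans _ (ler_norm _))// lerB//; exact: nondecreasing_cvgn_le.
move=> m n Nm Nn; have [mn|/ltnW nm] := leqP m n; last exact: key.
by rewrite hnormBC; exact: key.
Qed.

(** * Bessel's inequality and Fourier expansion along an orthonormal sequence *)

Section orthonormal_sequence.
Variable e : nat -> H.
Hypothesis eON : forall m n, dot (e m) (e n) = (m == n)%:R.

Definition fsum u n := \sum_(k < n) dot u (e k) *: e k.

Lemma dot_sum_lt (c : nat -> R[i]) m n k : (m <= k < n)%N ->
  dot (\sum_(m <= j < n) c j *: e j) (e k) = c k.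
Proof.
move=> mkn; rewrite dot_suml (bigD1_seq k) ?mem_index_iota ?iota_uniq//=.
rewrite dotZl eON eqxx mulr1 big1 ?addr0// => j /negbTE jk.
by rewrite dotZl eON jk mulr0.
Qed.

Lemma dot_sum_ge (c : nat -> R[i]) m n k : (n <= k)%N ->
  dot (\sum_(m <= j < n) c j *: e j) (e k) = 0.
Proof.
move=> nk; rewrite dot_suml big_nat big1// => j /andP[_ jn].
by rewrite dotZl eON ltn_eqF ?mulr0// (leq_trans jn).
Qed.

Lemma sqr_hnorm_sum (c : nat -> R[i]) m n :
  hnorm (\sum_(m <= k < n) c k *: e k) ^+ 2 = \sum_(m <= k < n) normc (c k) ^+ 2.
Proof.
have [mn|nm] := leqP m n; last by rewrite !big_geq ?hnorm0 ?expr0n// ltnW.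
elim: n mn => [|n ih]; first by rewrite leqn0 => /eqP ->; rewrite !big_geq// hnorm0 expr0n.
rewrite leq_eqVlt => /predU1P[->|mn]; first by rewrite !big_geq// hnorm0 expr0n.
rewrite !big_nat_recr//= sqr_hnormD ih// dotZr dot_sum_ge// mulr0 mulr0 addr0.
rewrite hnormZ exprMn; congr (_ + _); rewrite sqr_hnorm eON eqxx.
by rewrite /= mulr1.
Qed.

Lemma fsumE u n : fsum u n = \sum_(0 <= k < n) dot u (e k) *: e k.
Proof. by rewrite big_mkord. Qed.

(** The remainder [r] after [n] terms still has coefficient [c = <u, e_n>] on [e n]; subtracting
    [c e_n] therefore changes its squared norm by [|c|^2 - 2 |c|^2]. *)
Lemma bessel_eq u n : hnorm (u - fsum u n) ^+ 2 =
  hnorm u ^+ 2 - \sum_(0 <= k < n) normc (dot u (e k)) ^+ 2.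
Proof.
elim: n => [|n ih]; first by rewrite /fsum big_ord0 big_geq// !subr0.
rewrite fsumE !big_nat_recr//= -fsumE.
set r := u - fsum u n in ih *; set c := dot u (e n).
have rn : dot r (e n) = c by rewrite /r dotBl fsumE dot_sum_ge// subr0.
rewrite opprD addrA -/r -scaleNr sqr_hnormD ih hnormZ exprMn (sqr_hnorm (e n)) eON eqxx normcN.
rewrite dotZr rn normc_sqr; case: c {rn} => x y /=; ring.
Qed.

Lemma bessel u n : \sum_(0 <= k < n) normc (dot u (e k)) ^+ 2 <= hnorm u ^+ 2.
Proof. by rewrite -subr_ge0 -bessel_eq sqr_ge0. Qed.

Lemma hnorm_fsum_le u n : hnorm (fsum u n) <= hnorm u.
Proof.
rewrite -(@ler_pXn2r _ 2)// ?nnegrE ?hnorm_ge0// fsumE sqr_hnorm_sum.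
exact: bessel.
Qed.

Lemma normc_dot_le u k : normc (dot u (e k)) <= hnorm u.
Proof.
rewrite -(@ler_pXn2r _ 2)// ?nnegrE ?hnorm_ge0// ?normc_ge0//.
rewrite (le_trans _ (bessel u k.+1))// big_nat_recr//= lerDr.
by apply: sumr_ge0 => i _; rewrite sqr_ge0.
Qed.

Lemma fsumB u m n : (m <= n)%N ->
  fsum u n - fsum u m = \sum_(m <= k < n) dot u (e k) *: e k.
Proof.
by move=> mn; rewrite !fsumE (big_cat_nat (n := m) (leq0n m) mn)/= addrAC subrr add0r.
Qed.

Lemma hcauchy_fsum u : hcauchy (fsum u).
Proof.
apply: (hcauchy_dom (b := fun n => \sum_(0 <= k < n) normc (dot u (e k)) ^+ 2)).
  move=> m n mn; rewrite fsumB// sqr_hnorm_sum.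
  by rewrite (big_cat_nat (n := m) (leq0n m) mn)/= addrAC subrr add0r.
by exists (hnorm u ^+ 2) => n; exact: bessel.
Qed.

Hypothesis Hcomplete : hcomplete.
Hypothesis etotal : forall u, (forall k, dot u (e k) = 0) -> u = 0.

(** The partial sums converge to some [l] by completeness. Once [n > k], [fsum u n] has the same
    [k]-th coefficient as [u], so that of [u - l] is at most [|fsum u n - l|], which tends to 0;
    totality gives [u = l]. *)
Lemma fsum_cvg u : hcvg (fsum u) u.
Proof.
have [l ul] := Hcomplete (@hcauchy_fsum u).
suff : u - l = 0 by move/eqP; rewrite subr_eq0 => /eqP ul'; rewrite {2}ul'.
apply: etotal => k; apply: Normc.eq0_normc; apply/eqP.
rewrite eq_le normc_ge0 andbT -(normr0 R).
have h1 : normc (dot (u - l) (e k)) @[_ --> \oo] --> normc (dot (u - l) (e k)).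
  exact: cvg_cst.
rewrite normr0; apply: (ler_cvg_to h1 ul); exists k.+1 => // n /= kn.
have -> : dot (u - l) (e k) = dot (fsum u n - l) (e k).
  by rewrite !dotBl fsumE dot_sum_lt.
exact: normc_dot_le.
Qed.

Lemma total_orthonormal_basis : orthonormal_basis dot e.
Proof.
split=> // u eps eps0; have /cvgrPdist_lt/(_ _ eps0)[N _ /(_ N)] := fsum_cvg u.
rewrite /= sub0r normrN ger0_norm ?hnorm_ge0// hnormBC => /(_ (leqnn N)) uN.
by exists N, (fun k => dot u (e k)).
Qed.

(** * Paley-Wiener criterion: inverting a small perturbation of an orthonormal basis *)

Section perturbation.
Variables (f : nat -> H) (q : R).
Hypothesis q1 : 0 <= q < 1.
Hypothesis fe : forall (c : nat -> R[i]) m n,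
  hnorm (\sum_(m <= k < n) c k *: (f k - e k)) <=
  q * hnorm (\sum_(m <= k < n) c k *: e k).

Let t u n := \sum_(0 <= k < n) dot u (e k) *: (f k - e k).

(** [fe] applied to the block between [m] and [n] bounds an increment of [t u] by [q < 1] times that
    of the Fourier sums, which are already Cauchy. *)
Let t_cauchy u : hcauchy (t u).
Proof.
have /andP[q0 ltq1] := q1.
have key m n : (m <= n)%N -> hnorm (t u n - t u m) <= hnorm (fsum u n - fsum u m).
  move=> mn; rewrite fsumB// /t (big_cat_nat (n := m) (leq0n m) mn)/= addrAC subrr add0r.
  by rewrite (le_trans (fe _ _ _))// ler_piMl ?hnorm_ge0// ltW.
move=> eps /(@hcauchy_fsum u)[N Ne]; exists N => m n Nm Nn.
have [mn|/ltnW nm] := leqP m n; last exact: le_lt_trans (key _ _ nm) (Ne _ _ Nm Nn).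
by rewrite hnormBC; exact: le_lt_trans (key _ _ mn) (Ne _ _ Nn Nm).
Qed.

Let perturbation_operator : exists T : {linear H -> H},
  (forall u, hnorm (T u) <= q * hnorm u) /\ forall k, T (e k) = f k - e k.
Proof.
have /choice[T Tt] : forall u, exists l, hcvg (t u) l.
  by move=> u; exact: Hcomplete.
have Tlin : linear T.
  move=> a u v; apply: (hcvg_unique (Tt _)).
  have := hcvgD (hcvgZ a (Tt u)) (Tt v); congr (hcvg _ _).
  apply/funext => n; rewrite /t scaler_sumr -big_split/=; apply: eq_bigr => k _.
  by rewrite dotDl dotZl scalerDl scalerA.
pose Tl : {linear H -> H} := HB.pack T (GRing.isLinear.Build _ _ _ _ T Tlin).
exists Tl; split=> [u|k].
  apply: (hcvg_norm_le (Tt u)); apply: nearW => n.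
  have /andP[q0 _] := q1.
  by rewrite (le_trans (fe _ _ _))// ler_wpM2l// -fsumE hnorm_fsum_le.
apply: (hcvg_unique (Tt _)).
(* For [n > k] the sum [t (e k) n] contains its only nonzero term and equals [f k - e k] exactly, so
   the majorant is eventually 0. *)
apply: (hcvg_squeeze (b := fun n => if (n <= k)%N then hnorm (t (e k) n - (f k - e k)) else 0)).
  move=> n; case: leqP => // kn.
  rewrite /t (bigD1_seq k) ?mem_index_iota ?iota_uniq//= eON eqxx scale1r big1 ?addr0 ?subrr ?hnorm0//.
  by move=> j jk; rewrite eON eq_sym (negbTE jk) scale0r.
apply: cvg_near_cst; exists k.+1 => // n /= kn; first by rewrite leqNgt kn.
Qed.

(** [A = 1 + T] with [|T| <= q < 1] satisfies [|A u| >= (1 - q) |u|], which gives both injectivity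
    and the bound on the inverse. Only surjectivity needs the Neumann series. *)
Lemma riesz_basis_perturbation : riesz_basis dot f.
Proof.
have /andP[q0 ltq1] := q1.
have [T [Tq Te]] := perturbation_operator.
exists e; first exact: total_orthonormal_basis.
pose A : {linear H -> H} := idfun \+ T.
have AE u : A u = u + T u by [].
have Abelow u : (1 - q) * hnorm u <= hnorm (A u).
  rewrite AE mulrBl mul1r lerBlDr (le_trans _ (lerD (lexx _) (Tq u)))//.
  by rewrite -{1}[u](addrK (T u)) (le_trans (ler_hnormD _ _))// hnormN.
have q1' : 0 < 1 - q by rewrite subr_gt0.
have Ainj u v : A u = A v -> u = v.
  move=> Auv; apply/eqP; rewrite -subr_eq0; apply/eqP/hnorm0_eq0/eqP.
  rewrite eq_le hnorm_ge0 andbT -(pmulr_rle0 _ q1').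
  by rewrite (le_trans (Abelow _))// linearB Auv subrr hnorm0.
have Asurj v : exists u, A u = v.
  (* Fixed-point iteration for [u = v - T u]; its iterates are the partial sums of the Neumann
     series of [v]. *)
  pose x := fix x n := if n is m.+1 then v - T (x m) else 0.
  (* [M] solves [M = |v| + q M], so the ball of radius [M] is preserved by the iteration. *)
  pose M := hnorm v / (1 - q).
  have xM n : hnorm (x n) <= M.
    elim: n => [|n ih]; first by rewrite hnorm0 divr_ge0 ?hnorm_ge0 ?ltW.
    rewrite (le_trans (ler_hnormD _ _))// hnormN.
    rewrite (le_trans (lerD (lexx _) (le_trans (Tq _) (ler_wpM2l q0 ih))))//.
    by rewrite /M le_eqVlt; apply/orP; left; apply/eqP; field; rewrite gt_eqF.
  have xnp p n : hnorm (x (n + p)%N - x n) <= q ^+ n * M.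
    elim: n => [|n ih]; first by rewrite add0n expr0 mul1r subr0 xM.
    have -> : x (n.+1 + p)%N - x n.+1 = T (x n - x (n + p)%N).
      by rewrite addSn /= opprB linearB addrC addrA subrK.
    by rewrite exprS -mulrA (le_trans (Tq _))// ler_wpM2l// hnormBC.
  have M0 : 0 <= M by apply: divr_ge0; [exact: hnorm_ge0|exact: ltW].
  have qM0 : q ^+ n * M @[n --> \oo] --> (0 : R).
    by rewrite -(mul0r M); apply: cvgMl; apply: cvg_expr; rewrite ger0_norm.
  have [l xl] : exists l, hcvg x l.
    apply: Hcomplete => eps eps0.
    have /cvgrPdist_lt/(_ _ eps0)[N _ /(_ N (leqnn N))] := qM0.
    rewrite /= sub0r normrN (ger0_norm (mulr_ge0 (exprn_ge0 _ q0) M0)) => qN.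
    have key m n : (N <= m)%N -> (m <= n)%N -> hnorm (x n - x m) < eps.
      move=> Nm mn; rewrite -(subnKC mn) (le_lt_trans (xnp _ _))//.
      by rewrite (le_lt_trans _ qN)// ler_wpM2r// ler_wiXn2l// ltW.
    exists N => m n Nm Nn; have [mn|/ltnW nm] := leqP m n; last exact: key.
    by rewrite hnormBC; exact: key.
  have Txl : hcvg (fun n => T (x n)) (T l).
    apply: (hcvg_squeeze (b := fun n => q * hnorm (x n - l))).
      by move=> n; rewrite -linearB Tq.
    by rewrite -(mulr0 q); exact: cvgMr.
  exists l; rewrite AE; apply/eqP; rewrite eq_sym -subr_eq eq_sym; apply/eqP.
  apply: (hcvg_unique (hcvg_shift 1 xl)).
  apply: (hcvg_squeeze (b := fun n => hnorm (T (x n) - T l))) => // n.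
  by rewrite addn1/= opprB addrC addrA subrK hnormBC.
have /choice[B BE] := Asurj.
have Blin : linear B.
  by move=> a u v; apply: Ainj; rewrite linearP !BE.
pose Bl : {linear H -> H} := HB.pack B (GRing.isLinear.Build _ _ _ _ B Blin).
have BlE v : A (Bl v) = v by exact: BE.
exists A; last by move=> k; rewrite AE Te addrC subrK.
split.
  exists (1 + q) => u; rewrite AE mulrDl mul1r.
  by rewrite (le_trans (ler_hnormD _ _))// lerD.
exists Bl; split=> [|u|u].
- exists (1 - q)^-1 => u; rewrite -ler_pdivrMl ?invr_gt0// invrK.
  by rewrite (le_trans (Abelow _))// BlE.
- by apply: Ainj; rewrite BlE.
- exact: BlE.
Qed.

End perturbation.
End orthonormal_sequence.
End hilbert.

(** * Completeness of L_2 *)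

Section real_sequences.
Context (R : realType).

Lemma cvgn_geometric_steps (u : R^nat) (C : R) :
  (forall k, `|u k.+1 - u k| <= C * 2^-1 ^+ k) -> cvgn u.
Proof.
move=> uC.
have C0 : 0 <= C by rewrite (le_trans (normr_ge0 _) (le_trans (uC 0%N) _))// expr0 mulr1.
have uE : u = (fun n => u 0%N + series (fun k => u k.+1 - u k) n).
  apply/funext => n; rewrite seriesEnat/= telescope_sumr//; ring.
rewrite uE; apply: is_cvgD; first exact: is_cvg_cst.
apply: normed_cvg; apply: (series_le_cvg (v_ := geometric C 2^-1)) => //.
- by move=> n; exact: normr_ge0.
- by move=> n; apply: geometric_ge0.
- by apply: is_cvg_geometric_series; rewrite ger0_norm// invf_lt1// ltr1n.
Qed.

Lemma ereal_limn_le (u : (\bar R)^nat) (M : \bar R) :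
  cvgn u -> (forall n, (u n <= M)%E) -> (limn u <= M)%E.
Proof. by move=> cu uM; apply: lime_le => //; exact: nearW. Qed.

Lemma limn_einf_le_bound (u : (\bar R)^nat) (M : \bar R) :
  (forall n, (u n <= M)%E) -> (limn_einf u <= M)%E.
Proof.
move=> uM; rewrite limn_einf_lim; apply: ereal_limn_le; first exact: is_cvg_einfs.
by move=> n; rewrite (le_trans _ (uM n))//; apply: ereal_inf_lbound; exists n => /=.
Qed.
End real_sequences.

Section complex_numbers.
Context (R : realType).
Implicit Types z : R[i].

Lemma Re_sub z1 z2 : Re (z1 - z2) = Re z1 - Re z2.
Proof. by case: z1 z2 => [? ?] []. Qed.

Lemma Im_sub z1 z2 : Im (z1 - z2) = Im z1 - Im z2.
Proof. by case: z1 z2 => [? ?] []. Qed.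

Lemma Re_realM (a : R) z : Re (real_complex R a * z) = a * Re z.
Proof. by case: z => x y /=; rewrite mul0r subr0. Qed.

Lemma Im_realM (a : R) z : Im (real_complex R a * z) = a * Im z.
Proof. by case: z => x y /=; rewrite mul0r addr0. Qed.

Lemma ler_normc_Re z : `|Re z| <= normc z.
Proof. by case: z => x y /=; rewrite -sqrtr_sqr ler_wsqrtr// lerDl sqr_ge0. Qed.

Lemma ler_normc_Im z : `|Im z| <= normc z.
Proof. by case: z => x y /=; rewrite -sqrtr_sqr ler_wsqrtr// lerDr sqr_ge0. Qed.

(** Componentwise, so that real limit and measurability theorems apply to each part. *)
Definition ccvg (u : nat -> R[i]) (l : R[i]) :=
  Re (u n) @[n --> \oo] --> Re l /\ Im (u n) @[n --> \oo] --> Im l.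

Lemma ccvg_cst z : ccvg (fun=> z) z.
Proof. by split; exact: cvg_cst. Qed.

Lemma ccvgB u v l m : ccvg u l -> ccvg v m -> ccvg (fun n => u n - v n) (l - m).
Proof.
move=> [ur ui] [vr vi]; split.
  by rewrite Re_sub; under eq_fun do rewrite Re_sub; exact: cvgB.
by rewrite Im_sub; under eq_fun do rewrite Im_sub; exact: cvgB.
Qed.

Lemma ccvg_shift k u l : ccvg u l -> ccvg (fun n => u (n + k)%N) l.
Proof.
move=> [ur ui]; split.
  by rewrite (cvg_shiftn k (fun n => Re (u n))).
by rewrite (cvg_shiftn k (fun n => Im (u n))).
Qed.

End complex_numbers.

Section complex_functions.
Context d (T : measurableType d) (R : realType) (mu : {measure set T -> \bar R}).

Definition measurable_cfun (f : T -> R[i]) :=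
  measurable_fun setT (fun x => Re (f x)) /\ measurable_fun setT (fun x => Im (f x)).

Lemma measurable_cfunB (f g : T -> R[i]) : measurable_cfun f -> measurable_cfun g ->
  measurable_cfun (fun x : T => f x - g x).
Proof.
move=> [fr fi] [gr gi]; split.
  by under eq_fun do rewrite Re_sub; exact: measurable_funB.
by under eq_fun do rewrite Im_sub; exact: measurable_funB.
Qed.

Lemma measurable_sqr_normc (f : T -> R[i]) : measurable_cfun f ->
  measurable_fun setT (fun x => (normc (f x) ^+ 2)%:E).
Proof.
move=> [mr mi]; apply/measurable_EFinP; under eq_fun do rewrite normc_sqr.
by apply: measurable_funD; exact: measurable_funX.
Qed.

Lemma measurable_cfun_cvg (f : nat -> T -> R[i]) (g : T -> R[i]) :
  (forall n, measurable_cfun (f n)) -> (forall x, ccvg (f ^~ x) (g x)) ->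
  measurable_cfun g.
Proof.
move=> mf fg; split.
- by apply: (measurable_fun_cvg (h := fun n x => Re (f n x))) => [n|x _];
    [case: (mf n)|case: (fg x)].
- by apply: (measurable_fun_cvg (h := fun n x => Im (f n x))) => [n|x _];
    [case: (mf n)|case: (fg x)].
Qed.

Lemma ccvg_sqr_normc (u : nat -> R[i]) l : ccvg u l ->
  (normc (u n) ^+ 2)%:E @[n --> \oo] --> (normc l ^+ 2)%:E.
Proof.
move=> [ur ui]; apply: cvg_EFin; first exact: nearW.
rewrite normc_sqr !expr2; under eq_fun => n do rewrite /= normc_sqr !expr2.
by apply: cvgD; apply: cvgM.
Qed.

(** Lower semicontinuity of the L_2 norm under pointwise convergence. It serves twice: for the
    completeness of L_2 and for the passage to the limit in the Taylor expansion. *)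
Lemma fatou_sqr_normc (f : nat -> T -> R[i]) (g : T -> R[i]) (M : \bar R) :
  (forall n, measurable_cfun (f n)) -> (forall x, ccvg (f ^~ x) (g x)) ->
  (forall n, (\int[mu]_x (normc (f n x) ^+ 2)%:E <= M)%E) ->
  (\int[mu]_x (normc (g x) ^+ 2)%:E <= M)%E.
Proof.
move=> mf fg fM.
have -> : (fun x => (normc (g x) ^+ 2)%:E) =
    (fun x => limn_einf (fun n => (normc (f n x) ^+ 2)%:E)).
  apply/funext => x; have /ccvg_sqr_normc h := fg x.
  by rewrite is_cvg_limn_einfE; [rewrite (cvg_lim _ h)|apply/cvg_ex; eexists; exact: h].
apply: le_trans (fatou mu measurableT _ _) _.
- by move=> n; exact: measurable_sqr_normc.
- by move=> n x _; rewrite lee_fin sqr_ge0.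
exact: limn_einf_le_bound.
Qed.
End complex_functions.

Section L2_complete.
Context d (T : measurableType d) (R : realType) (mu : {measure set T -> \bar R}).
Local Notation H := (L2 mu).
Local Notation dot := (L2dot mu).
Local Notation hn := (hnorm (L2dot mu)).

Lemma measurable_L2fun (f : L2fun mu) : measurable_cfun f.
Proof. by have [] := L2funP f. Qed.

Lemma sqr_hnorm_L2class (f : L2fun mu) :
  (hn (L2class mu f) ^+ 2)%:E = (\int[mu]_x (normc (f x) ^+ 2)%:E)%E.
Proof.
rewrite sqr_hnorm -[X in Re X]/(L2dot mu _ _) L2dotE L2fun_dotff /= /Rintegral fineK//.
have [_ _ fi] := L2funP f.
by rewrite ge0_fin_numE// integral_ge0// => x _; rewrite lee_fin sqr_ge0.
Qed.

Lemma L2class_sub (f g : L2fun mu) : L2class mu f - L2class mu g = L2class mu (f - g).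
Proof. by rewrite -scaleN1r -L2classZ -L2classD scaleN1r. Qed.

Lemma L2funBE (f g : L2fun mu) x : (f - g) x = f x - g x.
Proof. by []. Qed.

Lemma sqr_hnorm_L2sub (u v : H) : (hn (u - v) ^+ 2)%:E =
  (\int[mu]_x (normc (repr u x - repr v x) ^+ 2)%:E)%E.
Proof. by rewrite -{1}[u]L2classK -{1}[v]L2classK L2class_sub sqr_hnorm_L2class. Qed.

Section fast_cauchy.
Variable g : nat -> H.
Hypothesis gfast : forall k, hn (g k.+1 - g k) < 4^-1 ^+ k.

(* The weights [4 ^+ k] make finiteness of [h x] bound [D k x] by a multiple of
   [2 ^- k], so that no integrability of the sum of the [D k] itself is needed. *)
Let D k x := normc (repr (g k.+1) x - repr (g k) x).
Let h x := (\sum_(k <oo) (4 ^+ k * D k x ^+ 2)%:E)%E.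

Let mD k : measurable_fun setT (fun x => (4 ^+ k * D k x ^+ 2)%:E).
Proof.
apply/measurable_EFinP; apply: measurable_funM => //; apply/measurable_EFinP.
exact: measurable_sqr_normc (measurable_L2fun (repr (g k.+1) - repr (g k))).
Qed.

Let D0 k x : (0 <= (4 ^+ k * D k x ^+ 2)%:E)%E.
Proof. by rewrite lee_fin mulr_ge0 ?sqr_ge0// exprn_ge0. Qed.

Let mh : measurable_fun setT h.
Proof. by apply: ge0_emeasurable_sum. Qed.

Let h0 x : (0 <= h x)%E.
Proof. exact: nneseries_ge0. Qed.

Let inth : (\int[mu]_x h x < +oo)%E.
Proof.
(* The [k]-th integral is [4 ^ k |g_(k+1) - g_k|^2 <= 4 ^ k 16 ^ -k = 4 ^ -k]; the constant is the
   sum of this geometric series. *)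
rewrite integral_nneseries//; apply: (@le_lt_trans _ _ ((1 - 4^-1)^-1)%:E); last exact: ltry.
apply: ereal_limn_le.
  by apply: is_cvg_nneseries => n _ _; exact: integral_ge0.
move=> n; apply: (@le_trans _ _ (\sum_(0 <= k < n) (4^-1 ^+ k)%:E)%E).
  apply: lee_sum => k _.
  under eq_integral do rewrite EFinM.
  rewrite ge0_integralZl//; last 2 first.
  - exact: measurable_sqr_normc (measurable_L2fun (repr (g k.+1) - repr (g k))).
  - by move=> x _; rewrite lee_fin sqr_ge0.
  rewrite -sqr_hnorm_L2sub -EFinM lee_fin.
  rewrite (@le_trans _ _ (4 ^+ k * (4^-1 ^+ k) ^+ 2))//.
    by rewrite ler_wpM2l ?exprn_ge0// lerXn2r ?nnegrE ?hnorm_ge0 ?exprn_ge0// ltW.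
  by rewrite expr2 mulrA -exprMn divff// expr1n mul1r.
rewrite sumEFin lee_fin.
have := @geometric_le_lim R n 1 4^-1; rewrite seriesEnat /= /geometric/=.
rewrite mul1r (eq_bigr (fun k => 4^-1 ^+ k)); last by move=> k _; rewrite mul1r.
by apply=> //; rewrite ger0_norm// invf_lt1// ltr1n.
Qed.

Let A := [set x | h x < +oo]%E.

Let mA : measurable A.
Proof.
rewrite -[A]setTI (_ : A = h @^-1` [set y | y < +oo]%E)//.
apply: mh => //; rewrite (_ : [set y | y < +oo]%E = ~` [set +oo%E]).
  by apply: measurableC; exact: emeasurable_set1.
apply/seteqP; split => y /=; first by move=> + yE; rewrite yE ltxx.
by move/eqP; rewrite ltey.
Qed.

Let aeA : {ae mu, forall x, A x}.
Proof.
have ih : mu.-integrable setT h.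
  apply/integrableP; split => //.
  by under eq_integral => x _ do rewrite gee0_abs//; exact: inth.
by apply: filterS (integrable_ae measurableT ih) => x /(_ I); rewrite ge0_fin_numE.
Qed.

(** Cutting off to the full-measure set [A] turns almost everywhere convergence into convergence at
    every point, the form [fatou_sqr_normc] requires. *)
Let G k x : R[i] := real_complex R (\1_A x) * repr (g k) x.

Let mG k : measurable_cfun (G k).
Proof.
have [mr mi] := measurable_L2fun (repr (g k)).
split; rewrite /G; [under eq_fun do rewrite Re_realM|under eq_fun do rewrite Im_realM];
  by apply: measurable_funM => //; exact: measurable_indic.
Qed.

(** A single term of a nonnegative series is at most its sum, so [4 ^ k D_k(x)^2 <= h x]; take
    square roots. *)
Let D_geometric x : A x -> exists C, forall k, D k x <= C * 2^-1 ^+ k.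
Proof.
move=> Ax; exists (Num.sqrt (fine (h x))) => k.
have hE : h x = (fine (h x))%:E by rewrite fineK// ge0_fin_numE.
have hk : 4 ^+ k * D k x ^+ 2 <= fine (h x).
  rewrite -lee_fin -hE (le_trans _ (nneseries_lim_ge k.+1 _))//.
  by rewrite big_nat_recr//= leeDr// sume_ge0.
rewrite -(@ler_pM2r _ (2 ^+ k)) ?exprn_gt0// -mulrA -exprMn mulVf// expr1n mulr1.
rewrite -(@ler_pXn2r _ 2)// ?nnegrE ?sqrtr_ge0//; last first.
  by rewrite mulr_ge0 ?exprn_ge0 ?normc_ge0.
have t0 : 0 <= 4 ^+ k * D k x ^+ 2 by rewrite -lee_fin; exact: D0.
rewrite sqr_sqrtr ?(le_trans t0)//.
rewrite (le_trans _ hk)// exprMn mulrC -exprM mulnC exprM.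
by rewrite (_ : 2 ^+ 2 = 4)//; ring.
Qed.

Let Gstep x : exists C, forall k, normc (G k.+1 x - G k x) <= C * 2^-1 ^+ k.
Proof.
have [Ax|Ax] := pselect (A x).
  have [C DC] := D_geometric Ax; exists C => k.
  rewrite /G indicE mem_set// -mulrBr normcM normc_real_complex normr1 mul1r.
  exact: DC.
exists 0 => k; rewrite /G indicE memNset// !mul0r subrr.
by rewrite (normc_real_complex 0) normr0.
Qed.

Let l x := Complex (limn (fun k => Re (G k x))) (limn (fun k => Im (G k x))).

Let G_cvg x : ccvg (G ^~ x) (l x).
Proof.
have [C GC] := Gstep x; split; rewrite /l /=.
- apply: cvgn_geometric_steps => k; apply: le_trans (GC k).
  by apply: le_trans (ler_normc_Re _); case: (G k.+1 x) (G k x) => [? ?] [? ?].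
- apply: cvgn_geometric_steps => k; apply: le_trans (GC k).
  by apply: le_trans (ler_normc_Im _); case: (G k.+1 x) (G k x) => [? ?] [? ?].
Qed.

Let l_dist (v : H) K (e : R) : (forall k, (K <= k)%N -> hn (g k - v) <= e) ->
  (\int[mu]_x (normc (l x - repr v x) ^+ 2)%:E <= (e ^+ 2)%:E)%E.
Proof.
move=> ge; apply: (fatou_sqr_normc (f := fun k x => G (k + K)%N x - repr v x)).
- by move=> n; apply: measurable_cfunB => //; exact: measurable_L2fun.
- by move=> x; exact: ccvgB (ccvg_shift K (G_cvg x)) (ccvg_cst _).
move=> n; rewrite (@le_trans _ _ (hn (g (n + K)%N - v) ^+ 2)%:E)//; last first.
  rewrite lee_fin lerXn2r ?nnegrE ?hnorm_ge0//.
    by rewrite (le_trans (hnorm_ge0 _ _) (ge K _)).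
  by rewrite ge// leq_addl.
rewrite sqr_hnorm_L2sub le_eqVlt; apply/orP; left; apply/eqP.
apply: ge0_ae_eq_integral => //.
- apply: measurable_sqr_normc; apply: measurable_cfunB => //; exact: measurable_L2fun.
- exact: measurable_sqr_normc (measurable_L2fun (repr (g (n + K)%N) - repr v)).
- by move=> x _; rewrite lee_fin sqr_ge0.
- by move=> x _; rewrite lee_fin sqr_ge0.
by apply: filterS aeA => x Ax _; rewrite /G indicE mem_set// mul1r.
Qed.

(** The limit is described by closed balls: a ball about any [v] that contains a tail of [g]
    contains [u]. Taking for [v] a late term of a Cauchy sequence with subsequence [g] then gives
    convergence of the whole sequence directly. *)
Lemma fast_cauchy_limit : exists u : H, forall (v : H) K (e : R),
  (forall k, (K <= k)%N -> hn (g k - v) <= e) -> hn (u - v) <= e.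
Proof.
have g0 k : hn (g k - g 0%N) <= 2 * (1 - 4^-1 ^+ k).
  elim: k => [|k ih]; first by rewrite subrr hnorm0 expr0 subrr mulr0.
  rewrite (le_trans (ler_hnormB_trans _ (g k) _ _))//.
  rewrite (le_trans (lerD (ltW (gfast k)) ih))// {ih}.
  by have : 0 <= (4^-1 : R) ^+ k by [rewrite exprn_ge0]; rewrite exprS; lra.
have lB : l \in @sqint _ _ _ mu.
  (* The norm bound is available for differences only: [l - g 0] has norm at most 2 by [l_dist], and
     [g 0] is added back. *)
  have -> : l = 1 *: (fun x => l x - repr (g 0%N) x) + L2fun_val (repr (g 0%N)).
    by apply/funext => x; rewrite !fctE /= scale1r subrK.
  apply: (sqint_submod_closed mu).2; last by case: (repr _).
  have [mr mi] := measurable_cfunB (measurable_cfun_cvg mG G_cvg)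
    (measurable_L2fun (repr (g 0%N))).
  apply/sqintP; split => //; apply: (@le_lt_trans _ _ (2 ^+ 2)%:E); last exact: ltry.
  apply: (l_dist (K := 0)) => k _; rewrite (le_trans (g0 k))//.
  by have : 0 <= (4^-1 : R) ^+ k by [rewrite exprn_ge0]; lra.
exists (L2class mu (MkL2fun lB)) => v K e ge.
have e0 : 0 <= e := le_trans (hnorm_ge0 _ _) (ge K (leqnn K)).
rewrite -(@ler_pXn2r _ 2)// ?nnegrE ?hnorm_ge0// -lee_fin.
by rewrite -[v]L2classK L2class_sub sqr_hnorm_L2class; exact: l_dist ge.
Qed.
End fast_cauchy.

Lemma L2_complete : hcomplete dot.
Proof.
move=> x xc.
have /choice[N NP] : forall k, exists N, forall m n, (N <= m)%N -> (N <= n)%N ->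
    hn (x m - x n) < 4^-1 ^+ k.
  by move=> k; apply: xc; rewrite exprn_gt0.
(* Summing makes [p k] dominate [N j] for every [j <= k], so that [p k] and [p k.+1] are both at
   least [N k]. *)
pose p k := (\sum_(j < k.+1) N j)%N.
have Np j k : (j <= k)%N -> (N j <= p k)%N.
  by move=> jk; rewrite /p (bigD1 (inord j))//= inordK// leq_addr.
have fast k : hn (x (p k.+1) - x (p k)) < 4^-1 ^+ k.
  by apply: NP; apply: Np.
have [u uP] := fast_cauchy_limit (g := x \o p) fast.
exists u; apply/cvgrPdist_lt => e e0.
have [k ke] : exists k, 4^-1 ^+ k < e.
  have : (4^-1 : R) ^+ n @[n --> \oo] --> (0 : R).
    by apply: cvg_expr; rewrite ger0_norm// invf_lt1// ltr1n.
  move=> /cvgrPdist_lt/(_ _ e0)[k _ /(_ k (leqnn k))] /=.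
  by rewrite sub0r normrN ger0_norm ?exprn_ge0//; exists k.
exists (N k) => // n /= kn; rewrite sub0r normrN ger0_norm ?hnorm_ge0// hnormBC.
apply: le_lt_trans ke; apply: (uP _ k) => j kj.
by rewrite ltW//=; apply: NP => //; exact: Np.
Qed.
End L2_complete.

(** * Fubini on the cube *)

Lemma bounded_integrable d (T : measurableType d) (R : realType)
    (mu : {measure set T -> \bar R}) (f : T -> R) (M : R) :
  (mu setT < +oo)%E -> measurable_fun setT f -> (forall x, `|f x| <= M) ->
  mu.-integrable setT (EFin \o f).
Proof.
move=> muT mf fM; apply/integrableP; split; first exact/measurable_EFinP.
apply: (@le_lt_trans _ _ (\int[mu]_x (cst `|M|%:E) x)%E).
  apply: ge0_le_integral => //=.
    by apply/measurable_EFinP; exact: measurableT_comp.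
  by move=> x _; rewrite lee_fin (le_trans (fM x))// ler_norm.
by rewrite integral_cst//= lte_mul_pinfty.
Qed.

Section edge_measure.
Context (R : realType).
Local Notation T := (measurableTypeR R).

Definition edge : set T := `[- pi, pi]%classic.

Lemma measurable_edge : measurable edge.
Proof. exact: measurable_itv. Qed.

Definition edge_measure : set T -> \bar R :=
  mrestr (@lebesgue_measure R) measurable_edge.

HB.instance Definition _ := Measure.on edge_measure.

Lemma edge_measureT : edge_measure setT = (2 * pi)%:E.
Proof.
rewrite /edge_measure /mrestr setTI /edge lebesgue_measure_itv/= lte_fin gtrN ?pi_gt0//=.
by rewrite -EFinD opprK mulr2n mulrDl !mul1r.
Qed.

Lemma edge_measure_fin : fin_num_fun edge_measure.
Proof. by apply: lty_fin_num_fun; rewrite [X in (X < _)%E]edge_measureT ltry. Qed.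

HB.instance Definition _ :=
  @Measure_isFinite.Build _ _ _ edge_measure edge_measure_fin.

Lemma integral_edge (f : T -> R) (M : R) : measurable_fun setT f ->
  (forall x, `|f x| <= M) ->
  (\int[edge_measure]_x (f x)%:E = \int[lebesgue_measure]_(x in edge) (f x)%:E)%E.
Proof.
move=> mf fM; have mI := measurable_edge.
have mN : measurable (~` edge) by exact: measurableC.
have iF : edge_measure.-integrable setT (EFin \o f).
  by apply: bounded_integrable mf fM; rewrite [ltLHS]edge_measureT ltry.
have -> := negligible_integral mN measurableT iF.
  rewrite setDE setTI setCK; apply: eq_measure_integral => A mA AI.
  by rewrite /= /edge_measure /mrestr setIidl.
by rewrite /= /edge_measure /mrestr setICl.
Qed.

Lemma preimage_cube_cons n : @cons_pair R n @^-1` cube R n.+1 =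
  edge `*` cube R n.
Proof.
rewrite /edge; apply/seteqP; split=> -[x y] /=.
  move=> h; split; first by rewrite /= in_itv/=; exact: (h ord0).
  by move=> i; have := h (lift ord0 i); rewrite tnthS.
rewrite in_itv/= => -[hx hy] i.
by case: (unliftP ord0 i) => [j ->|->]; rewrite ?tnthS ?tnth0.
Qed.

(** Restricting a product measure to a rectangle agrees on rectangles with the product of the
    restrictions, hence everywhere by uniqueness of the product measure. *)
Lemma cube_measure_cons n (A : set (n.+1.-tuple T)) : measurable A ->
  cube_measure R n.+1 A =
  pushforward (edge_measure \x cube_measure R n)%E (@cons_pair R n) A.
Proof.
move=> mA; rewrite /pushforward.
have mI := measurable_edge.
have mQ : measurable (edge `*` cube R n).
  by apply: measurableX => //; exact: measurable_cube.
pose m' := mrestr (@lebesgue_measure R \x lebesgue_tuple R n)%E mQ.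
have mcA : measurable (@cons_pair R n @^-1` A).
  by rewrite -[X in measurable X]setTI; exact: measurable_cons_pair.
rewrite (@product_measure_unique _ _ _ _ _ _ _ m')//.
  by rewrite /cube_measure/= /mrestr /= /lebesgue_cons /pushforward preimage_setI preimage_cube_cons.
move=> B C mB mC; rewrite /m' /= /mrestr -setXI product_measure1E//.
- exact: measurableI.
- by apply: measurableI => //; exact: measurable_cube.
Qed.

Lemma integral_cubeS n (F : n.+1.-tuple T -> R) (M : R) :
  measurable_fun setT F -> (forall x, `|F x| <= M) ->
  (\int[cube_measure R n.+1]_x (F x)%:E =
   \int[edge_measure]_x \int[cube_measure R n]_y (F (cons_pair (x, y)))%:E)%E.
Proof.
move=> mF FM.
have mcons := @measurable_cons_pair R n.
rewrite (eq_measure_integral (pushforward (edge_measure \x cube_measure R n)%E (@cons_pair R n))); last first.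
  by move=> A mA _; exact: cube_measure_cons.
have iF : (edge_measure \x cube_measure R n)%E.-integrable setT
    (EFin \o (F \o @cons_pair R n)).
  have mFc : measurable_fun setT (F \o @cons_pair R n) by exact: measurableT_comp.
  have PT : ((edge_measure \x cube_measure R n)%E (setT `*` setT) < +oo)%E.
    rewrite product_measure1E//.
    by rewrite [X in (X * _)%E]edge_measureT [X in (_ * X)%E]cube_measureT -EFinM ltry.
  by rewrite setXTT in PT; exact: bounded_integrable PT mFc (fun x => FM _).
rewrite integral_pushforward//; last exact/measurable_EFinP.
by rewrite -integral12_prod_meas1.
Qed.
End edge_measure.

Arguments edge_measure : clear implicits.
Arguments edge : clear implicits.

(** * Cosine integrals over the cube *)

Section cos_integral.
Context (R : realType).
Local Notation T := (measurableTypeR R).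

Lemma ler_norm_cos (x : R) : `|cos x| <= 1.
Proof. by rewrite ler_norml cos_geN1 cos_le1. Qed.

Lemma sin_int_pi (m : int) (a : R) : sin (m%:~R * pi + a) = sin (- (m%:~R * pi) + a).
Proof.
have pos n (b : R) : sin (n%:R * pi + b) = sin (- (n%:R * pi) + b).
  rewrite -(periodicn (@sinD2pi R) n (- (n%:R * pi) + b)); congr sin.
  by rewrite -mulrnA -[pi *+ _]mulr_natr natrM; ring.
case: m => n; first exact: pos.
by rewrite NegzE mulrNz mulNr opprK -pos.
Qed.

Lemma continuous_affine (m a : R) : continuous (fun x : R => m * x + a).
Proof. by move=> x; apply: cvgD; [apply: cvgMr; exact: cvg_id|exact: cvg_cst]. Qed.

Lemma continuous_cos_affine (m a : R) : continuous (fun x : R => cos (m * x + a)).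
Proof.
by move=> x; apply: continuous_comp; [exact: continuous_affine|exact: continuous_cos].
Qed.

Lemma measurable_cos_affine (m a : R) :
  measurable_fun [set: T] (fun x : T => cos (m * x + a)).
Proof.
exact: continuous_measurable_fun (@continuous_cos_affine m a).
Qed.

Lemma integral_cos_edge (m : int) (a : R) :
  (\int[edge_measure R]_x (cos (m%:~R * x + a))%:E =
   (if m == 0 then 2 * pi * cos a else 0)%:E)%E.
Proof.
case: (eqVneq m 0) => [->|m0].
  under eq_integral do rewrite mul0r add0r.
  by rewrite integral_cst// [X in (_ * X)%E]edge_measureT -EFinM mulrC.
rewrite (@integral_edge _ _ 1); [|exact: measurable_cos_affine|by move=> x; exact: ler_norm_cos].
have mR0 : m%:~R != 0 :> R by rewrite intr_eq0.
pose F (x : R) := m%:~R^-1 * sin (m%:~R * x + a).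
have dF (x : R) : is_derive x (1 : R) F (cos (m%:~R * x + a)).
  rewrite /F; apply: is_derive_eq.
  by rewrite addr0 /GRing.scale/= mulr1 [cos _ * _]mulrC mulrA mulVf// mul1r.
have cF : continuous F.
  move=> x; apply: cvgMr; apply: continuous_comp; first exact: continuous_affine.
  exact: continuous_sin.
rewrite /edge (@continuous_FTC2 _ _ F).
- by rewrite -EFinB /F mulrN -mulrBr sin_int_pi subrr mulr0.
- by rewrite gtrN// pi_gt0.
- by apply: continuous_subspaceT; exact: continuous_cos_affine.
- split; first by move=> x _; have [] := dF x.
  + by apply: cvg_at_right_filter; exact: cF.
  + by apply: cvg_at_left_filter; exact: cF.
- by move=> x _; rewrite derive1E; have [] := dF x.
Qed.

Definition freq n (k : n.-tuple int) : n.-tuple T := [tuple (tnth k i)%:~R | i < n].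

Lemma dotp_cons n (x t : T) (y u : n.-tuple T) :
  dotp (cons_pair (x, y)) [tuple of t :: u] = x * t + dotp y u.
Proof.
rewrite /dotp big_ord_recl !tnth0; congr (_ + _).
by apply: eq_bigr => i _; rewrite !tnthS.
Qed.

Lemma freq_cons n (m : int) (k : n.-tuple int) :
  freq [tuple of m :: k] = [tuple of m%:~R :: freq k].
Proof.
apply: eq_from_tnth => i; rewrite tnth_mktuple.
by case: (unliftP ord0 i) => [j ->|->]; rewrite ?tnthS ?tnth0// tnth_mktuple.
Qed.

Lemma measurable_cos_dotp n (t : n.-tuple T) (a : R) :
  measurable_fun setT (fun x => cos (dotp x t + a)).
Proof.
apply: measurableT_comp; first exact: continuous_measurable_fun (@continuous_cos R).
by apply: measurable_funD => //; exact: measurable_dotp.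
Qed.

(** The free phase [a] makes the induction on the dimension work: once the first coordinate [x] is
    peeled off, [m x] is absorbed into the phase of the remaining cosine. *)
Lemma integral_cos_cube n (k : n.-tuple int) (a : R) :
  (\int[cube_measure R n]_x (cos (dotp x (freq k) + a))%:E =
   (if k == nseq_tuple n 0 then (2 * pi) ^+ n * cos a else 0)%:E)%E.
Proof.
elim: n k a => [|n ih] k a.
  have -> : k == nseq_tuple 0 0 by apply/eqP/val_inj; case: k => -[].
  under eq_integral do rewrite /dotp big_ord0 add0r.
  by rewrite integral_cst// [X in (_ * X)%E]cube_measureT -EFinM mulrC.
case/tupleP: k => m k.
rewrite (@integral_cubeS _ _ _ 1); [|exact: measurable_cos_dotp|by move=> x; exact: ler_norm_cos].
have -> : ([tuple of m :: k] == nseq_tuple n.+1 0) = (m == 0) && (k == nseq_tuple n 0).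
  by rewrite -!val_eqE /= eqseq_cons.
transitivity (\int[edge_measure R]_x (if k == nseq_tuple n 0%R
    then ((2 * pi) ^+ n)%:E * (cos (m%:~R * x + a))%:E else 0)%E)%E.
  apply: eq_integral => x _.
  under eq_integral do rewrite freq_cons dotp_cons -addrA addrCA (mulrC x).
  by rewrite ih; case: ifP.
case: (k == _); last by rewrite integral0 andbF.
rewrite integralZl//; last first.
  apply: (@bounded_integrable _ _ _ _ _ 1); first by rewrite [ltLHS]edge_measureT ltry.
    exact: measurable_cos_affine.
  by move=> x; exact: ler_norm_cos.
rewrite integral_cos_edge andbT; case: (m == 0); rewrite ?mule0//.
by rewrite -EFinM exprSr !mulrA.
Qed.

Lemma measurable_tnth_preimage n (j : 'I_n) (B : set T) : measurable B ->
  measurable [set x : n.-tuple T | B (tnth x j)].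
Proof.
by move=> mB; have := @measurable_tnth _ T n j measurableT B mB; rewrite setTI.
Qed.

Lemma lebesgue_face0 n (j : 'I_n) (c : R) :
  lebesgue_tuple R n [set x | tnth x j = c] = 0%E.
Proof.
elim: n j => [[//]|n ih] j; rewrite /= /lebesgue_cons /pushforward.
have mface m (i : 'I_m) : measurable [set x : m.-tuple T | tnth x i = c].
  by apply: (@measurable_tnth_preimage _ _ [set c]); exact: measurable_set1.
case: (unliftP ord0 j) => [i ->|->].
  rewrite (_ : _ @^-1` _ = setT `*` [set y | tnth y i = c]).
    rewrite product_measure1E//; last exact: mface.
    by rewrite (ih i) mule0.
  by apply/seteqP; split=> -[x y] /=; rewrite tnthS// => -[].
rewrite (_ : _ @^-1` _ = [set c] `*` setT).
  have mc : measurable ([set c] : set T) by exact: measurable_set1.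
  rewrite product_measure1E//.
  by have /= -> := lebesgue_measure_set1 c; rewrite mul0e.
by apply/seteqP; split=> -[x y] /=; rewrite tnth0// => -[].
Qed.

(** Faces are discarded because the sign of [sin z] is that of [z] strictly between [- pi] and [pi],
    but fails to be at [- pi]. *)
Lemma ae_cube_interior n (j : 'I_n) :
  {ae cube_measure R n, forall x, - pi < tnth x j < pi}.
Proof.
have mface (c : R) : measurable [set x : n.-tuple T | tnth x j = c].
  by apply: (@measurable_tnth_preimage _ _ [set c]); exact: measurable_set1.
exists (~` cube R n `|` ([set x | tnth x j = - pi] `|` [set x | tnth x j = pi])); split.
- apply: measurableU; first by apply: measurableC; exact: measurable_cube.
  exact: measurableU.
- apply/eqP; rewrite eq_le measure_ge0 andbT /cube_measure /= /mrestr.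
  rewrite setIUl setICl set0U.
  apply: le_trans (measureIl _ _ _) _.
  + exact: measurableU.
  + exact: measurable_cube.
  apply: le_trans (measureU2 _ _ _) _ => //.
  by rewrite [X in (X + _)%E]lebesgue_face0 [X in (_ + X)%E]lebesgue_face0 adde0.
- move=> x /=; apply: contra_notP => /not_orP[/contrapT cx /not_orP[/eqP h1 /eqP h2]].
  have /andP[c1 c2] := cx j.
  by rewrite !lt_neqAle c1 c2 h2 eq_sym h1.
Qed.
End cos_integral.

(** * Completeness of the trigonometric system *)

Section step_approximation.
Context (R : realType).
Implicit Types (t y z : R) (m : nat).

Lemma bernoulli_ge t m : 0 <= t -> 1 + m%:R * t <= (1 + t) ^+ m.
Proof.
move=> t0; elim: m => [|m ih]; first by rewrite mul0r addr0 expr0.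
rewrite exprS (le_trans _ (ler_wpM2l _ ih)) ?addr_ge0//.
have : 0 <= m%:R * t * t by rewrite !mulr_ge0.
by rewrite -natr1; lra.
Qed.

Lemma bernoulli_1B_ge t m : 0 <= t <= 1 -> 1 - m%:R * t <= (1 - t) ^+ m.
Proof.
move=> /andP[t0 t1]; elim: m => [|m ih]; first by rewrite mul0r subr0 expr0.
rewrite exprS (le_trans _ (ler_wpM2l _ ih)) ?subr_ge0//.
have : 0 <= m%:R * t * t by rewrite !mulr_ge0.
by rewrite -natr1; lra.
Qed.

(** By Bernoulli, [(1 - t) ^ m (1 + m t) <= ((1 - t) (1 + t)) ^ m = (1 - t^2) ^ m <= 1]. *)
Lemma bernoulli_1B_le t m : 0 <= t <= 1 -> (1 - t) ^+ m <= (1 + m%:R * t)^-1.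
Proof.
move=> /andP[t0 t1]; have p : 0 < 1 + m%:R * t by rewrite ltr_wpDr// mulr_ge0.
rewrite -[leRHS]mul1r ler_pdivlMr//.
apply: le_trans (ler_wpM2l _ (bernoulli_ge m t0)) _.
  by rewrite exprn_ge0// subr_ge0.
rewrite -exprMn exprn_ile1//; first by rewrite mulr_ge0 ?subr_ge0// addr_ge0.
by have := sqr_ge0 t; rewrite expr2; lra.
Qed.

Lemma cvg_natrM_expr z : 0 <= z < 1 -> m%:R * z ^+ m @[m --> \oo] --> (0 : R).
Proof.
move=> /andP[z0 z1].
have [->|zn0] := eqVneq z 0.
  by apply: cvg_near_cst; exists 1%N => // m /= m0; rewrite expr0n gtn_eqF// mulr0.
(* Half of the decay absorbs the factor [m]: with [w^-1 = 1 + h], Bernoulli gives [m w ^ m <= h^-1],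
   and [m z ^ m = (m w ^ m) w ^ m]. *)
pose w := Num.sqrt z.
have w0 : 0 < w by rewrite sqrtr_gt0 lt_def zn0.
have w1 : w < 1 by rewrite -(sqrtr1 R) ltr_sqrt.
have zE : z = w ^+ 2 by rewrite sqr_sqrtr.
pose h := w^-1 - 1; have h0 : 0 < h by rewrite subr_gt0 invf_gt1.
have wm m : m%:R * w ^+ m <= h^-1.
  rewrite -[leRHS]mul1r ler_pdivlMr// mulrAC.
  have hm := bernoulli_ge m (ltW h0).
  have hw : 1 + h = w^-1 by rewrite /h addrC subrK.
  rewrite hw in hm.
  rewrite -(@ler_pM2r _ (w ^- m)) ?invr_gt0 ?exprn_gt0// mulfK ?gt_eqF ?exprn_gt0// mul1r.
  by rewrite -exprVn; rewrite (le_trans _ hm)// lerDr.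
apply: (@squeeze_cvgr _ _ _ _ (fun=> 0) (fun m => h^-1 * w ^+ m)).
- near=> m; rewrite mulr_ge0 ?exprn_ge0//= zE -exprM mulnC exprM expr2 mulrA.
  by rewrite ler_wpM2r// exprn_ge0// ltW.
- exact: cvg_cst.
- by rewrite -(mulr0 h^-1); apply: cvgMr; apply: cvg_expr; rewrite gtr0_norm.
Unshelve. all: by end_near. Qed.

(* Polynomials on [0, 1] converging boundedly to the indicator of [y < 1/2];
   the factor [m] in the exponent is what forces the limit 0 at [y = 1/2]. *)
Definition step_poly m y : R := (1 - y ^+ m) ^+ (m * 2 ^ m).

Lemma step_poly_itv m y : 0 <= y <= 1 -> 0 <= step_poly m y <= 1.
Proof.
move=> /andP[y0 y1]; have := exprn_ge0 m y0; have := exprn_ile1 m y0 y1.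
by move=> h1 h0; rewrite exprn_ge0 ?subr_ge0//= exprn_ile1 ?subr_ge0// gerBl.
Qed.

(** The exponent times [y ^ m] is [m (2 y) ^ m]. Below 1/2 it tends to 0 and the lower Bernoulli
    bound gives 1; from 1/2 on it is at least [m], and the upper bound gives at most
    [1 / (m + 1)]. *)
Lemma cvg_step_poly y : 0 <= y <= 1 ->
  step_poly m y @[m --> \oo] --> (if y < 2^-1 then 1 else 0 : R).
Proof.
move=> y01; have /andP[y0 y1] := y01.
have ym m : 0 <= y ^+ m <= 1 by rewrite exprn_ge0//= exprn_ile1.
have E m : (m * 2 ^ m)%:R * y ^+ m = m%:R * (2 * y) ^+ m.
  by rewrite natrM natrX exprMn mulrA.
case: ltP => yh.
  apply: (@squeeze_cvgr _ _ _ _ (fun m => 1 - m%:R * (2 * y) ^+ m) (fun=> 1)).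
  - near=> m; have /andP[_ ->] := step_poly_itv m y01; rewrite andbT -E.
    exact: bernoulli_1B_ge.
  - rewrite -[X in _ --> X]subr0; apply: cvgB; first exact: cvg_cst.
    by apply: cvg_natrM_expr; rewrite mulr_ge0//=; lra.
  - exact: cvg_cst.
apply: (@squeeze_cvgr _ _ _ _ (fun=> 0) (fun m => m.+1%:R^-1)).
- near=> m; have /andP[-> _] := step_poly_itv m y01; rewrite /=.
  rewrite (le_trans (bernoulli_1B_le _ (ym m)))// E lef_pV2 ?posrE//; last first.
    by rewrite ltr_wpDr// mulr_ge0// exprn_ge0// mulr_ge0.
  rewrite -natr1 addrC lerD2l ler_peMr// exprn_ege1//; lra.
- exact: cvg_cst.
- exact: cvg_harmonic.
Unshelve. all: by end_near. Qed.

End step_approximation.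

Section cosine_annihilator.
Context (R : realType) (n : nat).
Local Notation T := (measurableTypeR R).
Local Notation mu := (cube_measure R n).
Variable p : n.-tuple T -> R.
Hypothesis ip : mu.-integrable setT (EFin \o p).
Hypothesis pcos : forall (k : n.-tuple int) (a : R),
  (\int[mu]_x (p x * cos (dotp x (freq R k) + a))%:E = 0)%E.

Definition bounded_measurable (g : n.-tuple T -> R) :=
  measurable_fun setT g /\ exists M, forall x, `|g x| <= M.

Lemma integrable_mul_bounded g : bounded_measurable g ->
  mu.-integrable setT (fun x => (p x * g x)%:E).
Proof.
move=> [mg [M gM]].
have bg : [bounded g x | x in setT].
  exists `|M|; split; first exact: normr_real.
  by move=> y My x _ /=; rewrite (le_trans (gM x))// (le_trans (ler_norm M))// ltW.
have := integrableMl measurableT ip mg bg.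
by apply: eq_integrable => // x _; rewrite /= EFinM.
Qed.

(** Multipliers [g] for which [p g] is again orthogonal to all cosines. Having all frequencies and
    phases is what allows multiplication by [cos (x_j - b)]: the product-to-sum formula shifts [k_j]
    by 1 or -1 and the phase by [- b] or [b]. *)
Definition annihilated g := bounded_measurable g /\
  forall k a, (\int[mu]_x (p x * (g x * cos (dotp x (freq R k) + a)))%:E = 0)%E.

Lemma bounded_measurableM g h : bounded_measurable g -> bounded_measurable h ->
  bounded_measurable (fun x => g x * h x).
Proof.
move=> [mg [M gM]] [mh [N hN]]; split; first exact: measurable_funM.
by exists (M * N) => x; rewrite normrM ler_pM.
Qed.

Lemma bounded_measurable_cos t a :
  bounded_measurable (fun x => cos (dotp x t + a)).
Proof.
by split; [exact: measurable_cos_dotp|exists 1 => x; exact: ler_norm_cos].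
Qed.

Lemma annihilated_lin c g h : annihilated g -> annihilated h ->
  annihilated (fun x => c * g x + h x).
Proof.
move=> [bg g0] [bh h0]; have [mg [M gM]] := bg; have [mh [N hN]] := bh; split.
  split; first by apply: measurable_funD => //; exact: measurable_funM.
  exists (`|c| * M + N) => x; rewrite (le_trans (ler_normD _ _))// lerD// normrM.
  by rewrite ler_wpM2l.
move=> k a; have bc := bounded_measurable_cos (freq R k) a.
have ig := integrable_mul_bounded (bounded_measurableM bg bc).
have ih := integrable_mul_bounded (bounded_measurableM bh bc).
under eq_integral => x _.
  rewrite (_ : p x * _ = c * (p x * (g x * cos (dotp x (freq R k) + a)))
    + p x * (h x * cos (dotp x (freq R k) + a))); last by ring.
  rewrite EFinD EFinM; over.
rewrite integralD//; last exact: integrableZl.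
by rewrite integralZl// g0 h0 mule0 adde0.
Qed.

Lemma annihilated_lim (g : nat -> n.-tuple T -> R) h (M : R) :
  (forall m, annihilated (g m)) -> (forall m x, `|g m x| <= M) ->
  (forall x, g m x @[m --> \oo] --> h x) -> annihilated h.
Proof.
move=> ag gM gh.
have hM x : `|h x| <= M.
  have h1 : M @[_ --> \oo] --> M by exact: cvg_cst.
  have h2 : `|g m x| @[m --> \oo] --> `|h x| by apply: cvg_norm.
  by apply: (ler_cvg_to h2 h1); exact: nearW.
have mh : measurable_fun setT h.
  by apply: (measurable_fun_cvg (h := g)) => // m; have [[]] := ag m.
split; first by split => //; exists M.
move=> k a; have [mc _] := bounded_measurable_cos (freq R k) a.
have M0 : 0 <= M := le_trans (normr_ge0 _) (gM 0%N [tuple 0 | i < n]).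
have := @dominated_cvg _ _ _ mu setT measurableT
  (fun m x => (p x * (g m x * cos (dotp x (freq R k) + a)))%:E)
  (fun x => (p x * (h x * cos (dotp x (freq R k) + a)))%:E)
  (fun x => (`|p x * M|)%:E).
move=> /(_ _ _ _ _ _) dc.
have : (\int[mu]_x (p x * (g m x * cos (dotp x (freq R k) + a)))%:E)%E @[m --> \oo]
    --> (\int[mu]_x (p x * (h x * cos (dotp x (freq R k) + a)))%:E)%E.
  apply: dc => //.
  - by move=> m; apply: measurable_int (integrable_mul_bounded
      (bounded_measurableM (proj1 (ag m)) (bounded_measurable_cos _ _))).
  - move=> x _; apply: cvg_EFin; first exact: nearW.
    by apply: cvgMr; apply: cvgMl.
  - have := integrable_abse (integrable_mul_bounded (g := fun=> M) _).
    by apply; split => //; exists M => x; rewrite ger0_norm.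
  - move=> m x _; rewrite /= lee_fin normrM [leRHS]normrM ler_wpM2l// (ger0_norm M0) normrM.
    by rewrite -[leRHS]mulr1 ler_pM// ler_norm_cos.
move=> /cvg_lim => /(_ _)/= <-//.
rewrite (_ : (fun m => _) = (fun=> 0%E)); last first.
  by apply/funext => m; have [_ ->] := ag m.
by rewrite lim_cst.
Qed.

Lemma annihilated_ae g h : annihilated g -> bounded_measurable h ->
  {ae mu, forall x, g x = h x} -> annihilated h.
Proof.
move=> [bg g0] bh gh; split => // k a; rewrite -(g0 k a).
have bc := bounded_measurable_cos (freq R k) a.
apply: ae_eq_integral => //.
- exact: measurable_int (integrable_mul_bounded (bounded_measurableM bh bc)).
- exact: measurable_int (integrable_mul_bounded (bounded_measurableM bg bc)).
- by apply: filterS gh => x /= -> _.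
Qed.

Lemma dotp_freq_shift (k : n.-tuple int) (j : 'I_n) (s : int) (x : n.-tuple T) :
  dotp x (freq R [tuple tnth k i + (if i == j then s else 0) | i < n]) =
  dotp x (freq R k) + s%:~R * tnth x j.
Proof.
rewrite /dotp [RHS]addrC (bigD1 j)//= [in RHS](bigD1 j)//= addrA; congr (_ + _).
  by rewrite !tnth_mktuple eqxx rmorphD/=; ring.
by apply: eq_bigr => i /negbTE ij; rewrite !tnth_mktuple ij addr0.
Qed.

Lemma annihilated_mulcos (j : 'I_n) (b : R) g : annihilated g ->
  annihilated (fun x => cos (tnth x j - b) * g x).
Proof.
move=> ag; have [bg g0] := ag.
have bcj : bounded_measurable (fun x => cos (tnth x j - b)).
  split; last by exists 1 => x; exact: ler_norm_cos.
  apply: measurableT_comp; first exact: continuous_measurable_fun (@continuous_cos R).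
  by apply: measurable_funB => //; exact: measurable_tnth.
split; first exact: bounded_measurableM.
move=> k a; pose k' (s : int) := [tuple tnth k i + (if i == j then s else 0) | i < n].
have ic s c := integrable_mul_bounded
  (bounded_measurableM bg (bounded_measurable_cos (freq R (k' s)) c)).
under eq_integral => x _.
  rewrite (_ : p x * _ =
      2^-1 * (p x * (g x * cos (dotp x (freq R (k' 1)) + (a - b)))) +
      2^-1 * (p x * (g x * cos (dotp x (freq R (k' (-1))) + (a + b))))).
    rewrite EFinD [X in (X + _)%E]EFinM [X in (_ + X)%E]EFinM; over.
  rewrite !dotp_freq_shift mulN1r mul1r.
  set A := dotp x _; set y := tnth x j.
  rewrite (_ : A + y + (a - b) = (A + a) + (y - b)); last by ring.
  rewrite (_ : A - y + (a + b) = (A + a) - (y - b)); last by ring.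
  by set z := y - b; set c := A + a; rewrite (cosD c) (cosB c); field.
have ic1 := ic 1 (a - b); have icN1 := ic (-1) (a + b).
rewrite integralD//; [|exact: integrableZl|exact: integrableZl].
by rewrite !integralZl// !g0 mule0 adde0.
Qed.

Lemma eq_annihilated g h : g =1 h -> annihilated g -> annihilated h.
Proof. by move=> /funext ->. Qed.

Lemma annihilated0 g : annihilated g -> annihilated (fun=> 0).
Proof.
move=> ag; apply: eq_annihilated (annihilated_lin (-1) ag ag) => x.
by rewrite mulN1r addNr.
Qed.

Lemma annihilatedZ c g : annihilated g -> annihilated (fun x => c * g x).
Proof.
move=> ag; apply: eq_annihilated (annihilated_lin c ag (annihilated0 ag)) => x.
by rewrite addr0.
Qed.

(** Rescales the cosine to [[0, 1]], the domain of [step_poly], so that its threshold 1/2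
    corresponds to the cosine being 0. *)
Let y (j : 'I_n) (b : R) (x : n.-tuple T) : R := (1 + cos (tnth x j - b)) / 2.

Let y01 j b x : 0 <= y j b x <= 1.
Proof.
by have := cos_geN1 (tnth x j - b); have := cos_le1 (tnth x j - b); rewrite /y; lra.
Qed.

Lemma annihilated_mulX j b m g : annihilated g -> annihilated (fun x => y j b x ^+ m * g x).
Proof.
move=> ag; elim: m => [|m ih].
  by apply: eq_annihilated ag => x; rewrite expr0 mul1r.
apply: eq_annihilated (annihilated_lin 1 (annihilatedZ 2^-1 (annihilated_mulcos j b ih))
  (annihilatedZ 2^-1 ih)) => x.
by rewrite exprS; set c := _ ^+ m; rewrite /y; field.
Qed.

Lemma annihilated_step_poly j b m g : annihilated g ->
  annihilated (fun x => step_poly m (y j b x) * g x).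
Proof.
rewrite /step_poly; elim: (m * 2 ^ m)%N => [|N ih] ag.
  by apply: eq_annihilated ag => x; rewrite expr0 mul1r.
have := ih ag; set h := fun x => _ => ah.
apply: eq_annihilated (annihilated_lin (-1) (annihilated_mulX j b m ah) ah) => x.
by rewrite /h exprS; ring.
Qed.

(** Asking that multiplication by the indicator preserve all annihilated functions, rather than that
    the indicator be annihilated, gives intersections by composition, and hence a sigma-algebra. *)
Definition stable_set (E : set (n.-tuple T)) := measurable E /\
  forall g, annihilated g -> annihilated (fun x => \1_E x * g x).

Lemma stable_set_halfcircle (j : 'I_n) (b : R) :
  stable_set [set x | cos (tnth x j - b) < 0].
Proof.
split.
  have mc : measurable_fun [set: R] (fun z : R => cos (z - b)).
    apply: measurableT_comp; first exact: continuous_measurable_fun (@continuous_cos R).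
    exact: measurable_funB.
  apply: (@measurable_tnth_preimage _ n j [set z | cos (z - b) < 0]).
  have := mc measurableT _ (measurable_itv `]-oo, 0[); rewrite setTI.
  by congr measurable; apply/seteqP; split=> z /=; rewrite in_itv.
move=> g ag; have [[mg [M gM]] g0] := ag.
apply: (annihilated_lim (g := fun m x => step_poly m (y j b x) * g x) (M := M)).
- by move=> m; exact: annihilated_step_poly.
- move=> m x; rewrite normrM -[leRHS]mul1r ler_pM//.
  by have /andP[h0 h1] := step_poly_itv m (y01 j b x); rewrite ger0_norm.
- move=> x; apply: cvgMl.
  rewrite (_ : \1__ x = if y j b x < 2^-1 then 1 else 0).
    exact: cvg_step_poly.
  have -> : (y j b x < 2^-1) = (cos (tnth x j - b) < 0).
    by rewrite /y; apply/idP/idP; lra.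
  by rewrite indicE; case: ifPn => h; [rewrite mem_set|rewrite memNset//; exact/negP].
Qed.

Lemma stable_setT : stable_set setT.
Proof.
by split=> // g; apply: eq_annihilated => x; rewrite indicT mul1r.
Qed.

Lemma stable_setC E : stable_set E -> stable_set (~` E).
Proof.
move=> [mE sE]; split; first exact: measurableC.
move=> g ag; apply: eq_annihilated (annihilated_lin (-1) (sE _ ag) ag) => x.
by rewrite indicC indicE; case: (_ \in _) => /=; ring.
Qed.

Lemma stable_setI E F : stable_set E -> stable_set F -> stable_set (E `&` F).
Proof.
move=> [mE sE] [mF sF]; split; first exact: measurableI.
by move=> g ag; apply: eq_annihilated (sE _ (sF _ ag)) => x; rewrite indicI mulrA.
Qed.

Lemma stable_set_bigcup (F : nat -> set (n.-tuple T)) :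
  (forall k, stable_set (F k)) -> stable_set (\bigcup_k F k).
Proof.
move=> sF; split; first by apply: bigcupT_measurable => k; case: (sF k).
have GE m : \big[setI/setT]_(k < m) ~` F k = \bigcap_(k in `I_m) ~` F k.
  by rewrite (bigcap_mkord m (fun k => ~` F k)).
have sG m : stable_set (\big[setI/setT]_(k < m) ~` F k).
  elim/big_ind : _ => [|A B|k _]; [exact: stable_setT|exact: stable_setI|].
  exact: stable_setC.
move=> g ag; have [[mg [M gM]] g0] := ag.
(* Finite unions are written as complements of finite intersections, already known to be stable. At
   each point the indicators are eventually constant. *)
apply: (annihilated_lim (g := fun m x => \1_(~` \big[setI/setT]_(k < m) ~` F k) x * g x) (M := M)).
- by move=> m; case: (stable_setC (sG m)) => _; apply.
- move=> m x; rewrite normrM -[leRHS]mul1r ler_pM// ger0_norm//.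
- move=> x; apply: cvg_near_cst.
  have [[k _ Fkx]|nFx] := pselect ((\bigcup_k F k) x).
    exists k.+1 => // m /= km; rewrite !indicE !mem_set//; first by exists k.
    by rewrite /= GE => /(_ k km).
  exists 0%N => // m _; rewrite !indicE !memNset//.
  by rewrite /= => h; apply: h; rewrite GE => k _ Fkx; apply: nFx; exists k.
Qed.

Lemma stable_set_ae E F : stable_set E -> measurable F ->
  {ae mu, forall x, E x <-> F x} -> stable_set F.
Proof.
move=> [mE sE] mF EF; split => // g ag.
have [bg _] := ag.
apply: (annihilated_ae (sE _ ag)).
  apply: bounded_measurableM => //; split; first exact: measurable_indic.
  by exists 1 => x; rewrite ger0_norm// indicE; case: (_ \in _).
apply: filterS EF => x EFx; congr (_ * _); rewrite !indicE.
have -> // : (x \in E) = (x \in F) by apply/idP/idP; rewrite !inE => /EFx.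
Qed.

Let sin_lt0E (z : R) : - pi < z < pi -> (sin z < 0) = (z < 0).
Proof.
move=> /andP[z1 z2]; have [z0|z0|->] := ltgtP z 0.
- by rewrite -oppr_gt0 -sinN sin_gt0_pi// oppr_gt0 z0 ltrNl.
- by apply/negbTE; rewrite -leNgt ltW// sin_gt0_pi// z0.
- by rewrite sin0 ltxx.
Qed.

Let stable_set_sin (j : 'I_n) (b : R) : stable_set [set x | sin (tnth x j - b) < 0].
Proof.
have := stable_set_halfcircle j (b + pi / 2); congr stable_set.
by apply/seteqP; split=> x /=; rewrite opprD addrA cosBpihalf.
Qed.

(** For [- pi < x_j < pi], the condition [x_j < b] is trivial when [b] lies outside that interval.
    If [b <= 0] it means [sin x_j < 0] and [sin (x_j - b) < 0]; if [b > 0] it means one or the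
    other. The first sine confines [x_j - b] to [(- pi, pi)] exactly where the second one is
    consulted. *)
Lemma stable_set_ray (j : 'I_n) (b : R) : stable_set [set x | tnth x j < b].
Proof.
have mray : measurable [set x : n.-tuple T | tnth x j < b].
  have mb : measurable ([set z | z < b] : set T).
    have := measurable_itv (`]-oo, b[ : interval R).
    by congr measurable; apply/seteqP; split=> z /=; rewrite in_itv.
  exact: (measurable_tnth_preimage j mb).
have aej : {ae mu, forall x, - pi < tnth x j < pi} by exact: ae_cube_interior.
have FF := ae_filter_ringOfSetsType mu.
have [bpi|bpi] := leP b (- pi).
  apply: (stable_set_ae (stable_setC stable_setT)) => //.
  apply: (@filterS _ _ FF) aej => x /andP[x1 x2] /=.
  by split => [//|xb]; have := lt_trans (lt_le_trans xb bpi) x1; rewrite ltxx.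
have [pib|pib] := leP pi b.
  apply: (stable_set_ae stable_setT) => //.
  apply: (@filterS _ _ FF) aej => x /andP[x1 x2] /=.
  by split => // _; rewrite (lt_le_trans x2).
have S0 := stable_set_sin j 0; have Sb := stable_set_sin j b.
have [b0|b0] := leP b 0.
  apply: (stable_set_ae (stable_setI S0 Sb)) => //.
  apply: (@filterS _ _ FF) aej => x /andP[x1 x2] /=.
  rewrite subr0 sin_lt0E ?x1//; split=> [[x0]|xb].
    by rewrite sin_lt0E ?subr_lt0//; apply/andP; split; lra.
  have x0 : tnth x j < 0 by lra.
  by rewrite sin_lt0E ?subr_lt0//; apply/andP; split; lra.
apply: (stable_set_ae (stable_setC (stable_setI (stable_setC S0) (stable_setC Sb)))) => //.
apply: (@filterS _ _ FF) aej => x /andP[x1 x2] /=.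
rewrite subr0 sin_lt0E ?x1//; have [x0|x0] := ltP (tnth x j) 0.
  by split=> [_|_ []//]; rewrite (lt_trans x0).
rewrite sin_lt0E ?subr_lt0//; last by apply/andP; split; lra.
split=> [|xb []//]; by apply: contra_notP => xb; split.
Qed.

(** Generators are used twice: coordinate preimages generate the sigma-algebra on tuples, and open
    left rays generate the one on [R]. *)
Lemma stable_set_measurable (E : set (n.-tuple T)) : measurable E -> stable_set E.
Proof.
have sigmaS : sigma_algebra setT stable_set.
  split; first by rewrite -setCT; exact: stable_setC stable_setT.
    by move=> A; rewrite setTD; exact: stable_setC.
  by move=> F sF; exact: stable_set_bigcup.
apply: smallest_sub => //; elim/big_ind : _ => [A []|A B sA sB C [/sA|/sB]//|i _].
move=> A [B mB <-]; rewrite setTI; move: A B mB => _ B.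
have -> : (measurable : set (set T)) = <<s @RGenInftyO.G R >>.
  exact: RGenInftyO.measurableE.
pose S := [set B : set R | stable_set ((fun x : n.-tuple T => tnth x i) @^-1` B)].
suff GS : <<s @RGenInftyO.G R >> `<=` S by move=> /GS.
apply: smallest_sub; last first.
  move=> _ [b ->]; rewrite /S /= (_ : _ @^-1` _ = [set x | tnth x i < b]).
    exact: stable_set_ray.
  by apply/seteqP; split=> x /=; rewrite in_itv.
split.
- by rewrite /S /= preimage_set0 -setCT; exact: stable_setC stable_setT.
- by move=> A SA; rewrite setTD /S /= preimage_setC; exact: stable_setC.
- by move=> F SF; rewrite /S /= preimage_bigcup; exact: stable_set_bigcup.
Qed.

Theorem cosine_total : {ae mu, forall x, p x = 0}.
Proof.
have a1 : annihilated (fun=> 1).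
  split; first by split => //; exists 1 => x; rewrite normr1.
  by move=> k a; under eq_integral do rewrite mul1r.
(* Frequency 0 and phase 0 turn stability of [E] into the vanishing of the integral of [p] over
   [E]. *)
have pE : ae_eq mu setT (EFin \o p) (cst 0%E).
  apply: integral_ae_eq => // E _ mE; rewrite integral0.
  have [_ sE] := stable_set_measurable mE.
  have [_ /(_ (nseq_tuple n 0) 0)] := sE _ a1.
  move=> E0; rewrite -[RHS]E0 [LHS]integral_mkcond.
  apply: eq_integral => x _; rewrite patchE indicE mulr1.
  have -> : dotp x (freq R (nseq_tuple n 0)) = 0.
    by rewrite /dotp big1// => i _; rewrite tnth_mktuple tnth_nseq mulr0.
  by rewrite addr0 cos0 mulr1; case: ifP; rewrite ?mulr1 ?mulr0.
by apply: filterS pE => x /(_ I) [].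
Qed.

End cosine_annihilator.

(** * The exponential orthonormal basis *)

Section exponential_basis.
Context (R : realType) (n : nat).
Local Notation T := (measurableTypeR R).
Local Notation mu := (cube_measure R n).
Local Notation dot := (L2dot mu).

Let cn : R := ((2 * pi) `^ (n%:R / 2))^-1.

Let cn_sqr : cn * cn = ((2 * pi) ^+ n)^-1.
Proof.
have pi2 : 0 <= 2 * pi :> R by rewrite mulr_ge0// pi_ge0.
rewrite /cn -invfM -powRD; last first.
  by apply/implyP => _; rewrite gt_eqF// mulr_gt0// pi_gt0.
by rewrite (_ : _ + _ = n%:R); [rewrite powR_mulrn|field].
Qed.

Let Re_dot_exp (z : R[i]) (t x : n.-tuple T) : Re (z * conjc (exp_fun t x)) =
  cn * (Re z * cos (dotp x t) + Im z * sin (dotp x t)).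
Proof. by rewrite /exp_fun /expi -/cn; case: z => a b /=; ring. Qed.

Let Im_dot_exp (z : R[i]) (t x : n.-tuple T) : Im (z * conjc (exp_fun t x)) =
  cn * (Im z * cos (dotp x t) - Re z * sin (dotp x t)).
Proof. by rewrite /exp_fun /expi -/cn; case: z => a b /=; ring. Qed.

Lemma Rintegral_cos_cube (k : n.-tuple int) (a : R) :
  \int[mu]_x (cos (dotp x (freq R k) + a)) =
  if k == nseq_tuple n 0 then (2 * pi) ^+ n * cos a else 0.
Proof. by rewrite /Rintegral integral_cos_cube. Qed.

Definition subt (k l : n.-tuple int) : n.-tuple int :=
  [tuple tnth k i - tnth l i | i < n].

Lemma subt_eq0 k l : (subt k l == nseq_tuple n 0) = (k == l).
Proof.
apply/eqP/eqP => [kl|->]; apply: eq_from_tnth => i.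
  have := congr1 (fun t => tnth t i) kl; rewrite tnth_mktuple tnth_nseq.
  by move/eqP; rewrite subr_eq0 => /eqP.
by rewrite tnth_mktuple tnth_nseq subrr.
Qed.

Lemma dotp_freqB k l (x : n.-tuple T) :
  dotp x (freq R (subt k l)) = dotp x (freq R k) - dotp x (freq R l).
Proof.
rewrite /dotp -sumrB; apply: eq_bigr => i _.
by rewrite !tnth_mktuple rmorphB/=; ring.
Qed.

Let cube_fin : (mu setT < +oo)%E.
Proof. by rewrite [ltLHS]cube_measureT ltry. Qed.

Let icos t a : mu.-integrable setT (EFin \o (fun x => cos (dotp x t + a))).
Proof.
apply: (@bounded_integrable _ _ _ _ _ 1) => //; first exact: measurable_cos_dotp.
by move=> x; exact: ler_norm_cos.
Qed.

Lemma exp_L2_orthonormal k l :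
  dot (exp_L2 (freq R k)) (exp_L2 (freq R l)) = (k == l)%:R.
Proof.
rewrite L2dotE /L2fun_dot /cintegral.
have -> : \int[mu]_x Re (exp_fun (freq R k) x * conjc (exp_fun (freq R l) x)) =
    (k == l)%:R.
  transitivity (\int[mu]_x (cn * cn * cos (dotp x (freq R (subt k l)) + 0))).
    apply: eq_Rintegral => x _; rewrite Re_dot_exp dotp_freqB addr0 cosB.
    by rewrite /exp_fun Re_realM Im_realM /= -/cn; ring.
  rewrite RintegralZl// Rintegral_cos_cube subt_eq0 cn_sqr; case: eqP => _.
    by rewrite cos0 mulr1 mulVf// gt_eqF// exprn_gt0// mulr_gt0// pi_gt0.
  by rewrite mulr0.
have -> : \int[mu]_x Im (exp_fun (freq R k) x * conjc (exp_fun (freq R l) x)) = 0.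
  (* A sine is a cosine with phase [- pi / 2]; in the diagonal case the integral vanishes because
     [cos (- pi / 2) = 0]. *)
  transitivity (\int[mu]_x (cn * cn * cos (dotp x (freq R (subt k l)) + (- (pi / 2))))).
    apply: eq_Rintegral => x _; rewrite Im_dot_exp dotp_freqB cosBpihalf sinB.
    by rewrite /exp_fun Re_realM Im_realM /= -/cn; ring.
  rewrite RintegralZl// Rintegral_cos_cube subt_eq0; case: eqP => _.
    by rewrite cosN cos_pihalf !mulr0.
  by rewrite mulr0.
by case: eqP.
Qed.

(** On a finite measure space the constant 1 is in L_2, so [g = g * 1] is a product of two L_2
    functions. *)
Let L2_integrable (g : n.-tuple T -> R) : g \in Lfun mu 2%:E ->
  mu.-integrable setT (EFin \o g).
Proof.
move=> g2.
have one2 : (fun=> 1 : R) \in Lfun mu 2%:E.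
  apply/Lfun2P => //; under eq_integral do rewrite expr1n.
  by rewrite integral_cst// mul1e.
have /Lfun1_integrable := Lfun2_mul_Lfun1 g2 one2.
by apply: eq_integrable => // x _; rewrite /= mulr1.
Qed.

Definition oppt (k : n.-tuple int) : n.-tuple int := [tuple - tnth k i | i < n].

Lemma dotp_freqN k (x : n.-tuple T) : dotp x (freq R (oppt k)) = - dotp x (freq R k).
Proof.
rewrite /dotp -sumrN; apply: eq_bigr => i _.
by rewrite !tnth_mktuple rmorphN/= mulrN.
Qed.

Section total.
Variable f : L2fun mu.
Hypothesis f_orth : forall k, dot (L2class mu f) (exp_L2 (freq R k)) = 0.

Let fr x := Re (f x).
Let fi x := Im (f x).

Let ifr : mu.-integrable setT (EFin \o fr).
Proof. by apply: L2_integrable; have /square_integrableP[] := L2funP f. Qed.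

Let ifi : mu.-integrable setT (EFin \o fi).
Proof. by apply: L2_integrable; have /square_integrableP[] := L2funP f. Qed.

Let Ic g t := \int[mu]_x (g x * cos (dotp x t)).
Let Is g t := \int[mu]_x (g x * sin (dotp x t)).

Let igc g t : mu.-integrable setT (EFin \o g) ->
  mu.-integrable setT (EFin \o (fun x => g x * cos (dotp x t))).
Proof.
move=> ig; apply: (integrable_mul_bounded ig).
split; last by exists 1 => x; exact: ler_norm_cos.
by have := measurable_cos_dotp t 0; under eq_fun do rewrite addr0.
Qed.

Let igs g t : mu.-integrable setT (EFin \o g) ->
  mu.-integrable setT (EFin \o (fun x => g x * sin (dotp x t))).
Proof.
move=> ig; apply: (integrable_mul_bounded ig).
under eq_fun do rewrite -cosBpihalf; exact: bounded_measurable_cos.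
Qed.

Let cn0 : cn != 0.
Proof. by rewrite invr_eq0 gt_eqF// powR_gt0// mulr_gt0// pi_gt0. Qed.

Let f_orth_Re k : Ic fr (freq R k) + Is fi (freq R k) = 0.
Proof.
have := f_orth k; rewrite L2dotE /L2fun_dot /cintegral => -[+ _].
under eq_Rintegral do rewrite Re_dot_exp.
rewrite RintegralZl//; last exact: (integrableD measurableT (igc _ ifr) (igs _ ifi)).
rewrite RintegralD//; [|exact: igc|exact: igs].
by move=> /eqP; rewrite mulf_eq0 (negbTE cn0) => /eqP.
Qed.

Let f_orth_Im k : Ic fi (freq R k) - Is fr (freq R k) = 0.
Proof.
have := f_orth k; rewrite L2dotE /L2fun_dot /cintegral => -[_ +].
under eq_Rintegral do rewrite Im_dot_exp.
rewrite RintegralZl//; last exact: (integrableB measurableT (igc _ ifi) (igs _ ifr)).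
rewrite RintegralB//; [|exact: igc|exact: igs].
by move=> /eqP; rewrite mulf_eq0 (negbTE cn0) => /eqP.
Qed.

Let IcN g k : Ic g (freq R (oppt k)) = Ic g (freq R k).
Proof. by apply: eq_Rintegral => x _; rewrite dotp_freqN cosN. Qed.

Let IsN g k : mu.-integrable setT (EFin \o g) ->
  Is g (freq R (oppt k)) = - Is g (freq R k).
Proof.
move=> ig; rewrite -mulN1r -RintegralZl//; last exact: igs.
by apply: eq_Rintegral => x _; rewrite dotp_freqN sinN mulrN mulN1r.
Qed.

Let coefs_cos g : mu.-integrable setT (EFin \o g) ->
  (forall k, Ic g (freq R k) = 0) -> (forall k, Is g (freq R k) = 0) ->
  {ae mu, forall x, g x = 0}.
Proof.
move=> ig c0 s0; apply: (cosine_total ig) => k a.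
have ic := igc (freq R k) ig; have is_ := igs (freq R k) ig.
transitivity ((cos a * Ic g (freq R k) - sin a * Is g (freq R k))%:E); last first.
  by rewrite c0 s0 !mulr0 subrr.
rewrite -RintegralZl// -(RintegralZl (sin a))// -RintegralB//; last 2 first.
- exact: (integrableZl measurableT (cos a) ic).
- exact: (integrableZl measurableT (sin a) is_).
rewrite /Rintegral fineK.
  apply: eq_integral => x _; rewrite cosD; congr EFin; ring.
have := integrableB measurableT (integrableZl measurableT (cos a) ic)
  (integrableZl measurableT (sin a) is_).
by move=> /(integrable_fin_num measurableT).
Qed.

Lemma exp_L2_total : L2class mu f = 0.
Proof.
have E k : [/\ Ic fr (freq R k) = 0, Is fr (freq R k) = 0,
    Ic fi (freq R k) = 0 & Is fi (freq R k) = 0].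
  have h1 := f_orth_Re k; have h2 := f_orth_Im k.
  (* Orthogonality at [k] only ties a cosine to a sine coefficient. Cosine coefficients are even in
     [k] and sine coefficients odd, so adding the equations at [- k] isolates all four. *)
  have := f_orth_Re (oppt k); have := f_orth_Im (oppt k).
  rewrite !IcN !IsN// => h3 h4.
  by split; lra.
have r0 : {ae mu, forall x, fr x = 0} by apply: coefs_cos => // k; case: (E k).
have i0 : {ae mu, forall x, fi x = 0} by apply: coefs_cos => // k; case: (E k).
rewrite -(L2class0 mu); apply/L2class_eq.
apply: filterS2 r0 i0 => x; rewrite /fr /fi; case: (f x) => a b /= -> ->.
by [].
Qed.
End total.
End exponential_basis.

(** * Taylor expansion of the phase *)

Section complex_exponential_series.
Context (R : realType).
Implicit Types (s : R) (z : R[i]).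

Definition iC : R[i] := Complex 0 1.

Lemma iCX p : iC ^+ p =
  Complex ((~~ odd p)%:R * (-1) ^+ p./2) ((odd p)%:R * (-1) ^+ p.-1./2).
Proof.
elim: p => [|p ih]; first by rewrite expr0 /= mul1r mul0r.
rewrite exprS ih -(odd_double_half p); move: p./2 => k; case: (odd p).
  rewrite add1n /= odd_double uphalf_double half_double /=.
  by congr Complex; rewrite ?exprS; ring.
rewrite add0n /= odd_double uphalf_double half_double /=.
by congr Complex; ring.
Qed.

Definition expi_coeff s p : R[i] := iC ^+ p * real_complex R (s ^+ p / p`!%:R).

Lemma expi_coeff0 s : expi_coeff s 0 = 1.
Proof. by rewrite /expi_coeff !expr0 fact0 divr1 mul1r. Qed.

(** Isolates one factor [s], to be expanded as a sum over the coordinates in the norm recursion. *)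
Lemma expi_coeffS s p : expi_coeff s p.+1 =
  (iC * real_complex R p.+1%:R^-1) * (real_complex R s * expi_coeff s p).
Proof.
have E : s ^+ p.+1 / p.+1`!%:R = p.+1%:R^-1 * (s * (s ^+ p / p`!%:R)).
  by rewrite exprS factS natrM invfM; ring.
rewrite /expi_coeff E !rmorphM/= exprS; ring.
Qed.

Lemma Re_expi_coeff s p : Re (expi_coeff s p) = cos_coeff s p.
Proof.
by rewrite /expi_coeff iCX /cos_coeff /= mulr0 subr0 mulrA.
Qed.

Lemma Im_expi_coeff s p : Im (expi_coeff s p) = sin_coeff s p.
Proof.
by rewrite /expi_coeff iCX /sin_coeff /= mulr0 add0r mulrA.
Qed.

Lemma Re_sum (I : Type) (r : seq I) (F : I -> R[i]) :
  Re (\sum_(i <- r) F i) = \sum_(i <- r) Re (F i).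
Proof.
elim: r => [|i r ih]; first by rewrite !big_nil.
by rewrite !big_cons -ih; case: (F i) => ? ?; case: (\sum_(j <- r) F j).
Qed.

Lemma Im_sum (I : Type) (r : seq I) (F : I -> R[i]) :
  Im (\sum_(i <- r) F i) = \sum_(i <- r) Im (F i).
Proof.
elim: r => [|i r ih]; first by rewrite !big_nil.
by rewrite !big_cons -ih; case: (F i) => ? ?; case: (\sum_(j <- r) F j).
Qed.

Lemma cvg_expi_series s : ccvg (fun P => \sum_(0 <= p < P) expi_coeff s p) (expi s).
Proof.
split => /=.
  have := @is_cvg_series_cos_coeff R s; rewrite (cos.unlock) => h.
  rewrite (_ : (fun P => _) = series (cos_coeff s))//.
  by apply/funext => P; rewrite Re_sum seriesEnat/=; apply: eq_bigr => p _; rewrite Re_expi_coeff.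
have := @is_cvg_series_sin_coeff R s; rewrite (sin.unlock) => h.
rewrite (_ : (fun P => _) = series (sin_coeff s))//.
by apply/funext => P; rewrite Im_sum seriesEnat/=; apply: eq_bigr => p _; rewrite Im_expi_coeff.
Qed.

Lemma ccvgD (u v : nat -> R[i]) l m : ccvg u l -> ccvg v m ->
  ccvg (fun n => u n + v n) (l + m).
Proof.
move=> ul vm; rewrite -[m]opprK -[X in ccvg X](_ : (fun n => u n - (- v n)) = _).
  by apply: ccvgB => //; rewrite -sub0r; under eq_fun do rewrite -sub0r;
    apply: ccvgB => //; exact: ccvg_cst.
by apply/funext => n; rewrite opprK.
Qed.

Lemma ccvg_sum (I : Type) (r : seq I) (u : I -> nat -> R[i]) (l : I -> R[i]) :
  (forall i, ccvg (u i) (l i)) ->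
  ccvg (fun n => \sum_(i <- r) u i n) (\sum_(i <- r) l i).
Proof.
move=> ul; elim: r => [|i r ih].
  rewrite big_nil; under eq_fun do rewrite big_nil; exact: ccvg_cst.
by rewrite big_cons; under eq_fun do rewrite big_cons; exact: ccvgD.
Qed.

Lemma ccvgMl (a : R[i]) (u : nat -> R[i]) l : ccvg u l -> ccvg (fun n => a * u n) (a * l).
Proof.
case: a l => a b [x y] [/= ur ui]; split => /=.
  rewrite (_ : (fun n => _) = (fun n => a * Re (u n) - b * Im (u n))).
    by apply: cvgB; exact: cvgMr.
  by apply/funext => n; case: (u n).
rewrite (_ : (fun n => _) = (fun n => a * Im (u n) + b * Re (u n))).
  by apply: cvgD; exact: cvgMr.
by apply/funext => n; case: (u n).
Qed.

Lemma sum_exp_coeff_le (x : R) P : 0 <= x ->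
  \sum_(1 <= p < P.+1) x ^+ p / p`!%:R <= expR x - 1.
Proof.
move=> x0; rewrite lerBrDl.
have -> : 1 + \sum_(1 <= p < P.+1) x ^+ p / p`!%:R = series (exp_coeff x) P.+1.
  by rewrite seriesEnat/= [RHS]big_ltn//= /exp_coeff/= expr0 fact0 divr1.
apply: nondecreasing_cvgn_le; last exact: is_cvg_series_exp_coeff.
by apply/nondecreasing_seqP => k; rewrite !seriesEnat/= big_nat_recr//= lerDl divr_ge0// exprn_ge0.
Qed.

End complex_exponential_series.

Section L2fun_operations.
Context d (T : measurableType d) (R : realType) (mu : {measure set T -> \bar R}).
Local Notation dot := (L2dot mu).
Local Notation hn := (hnorm (L2dot mu)).

Lemma L2fun_sumE (I : Type) (r : seq I) (F : I -> L2fun mu) x :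
  (\sum_(i <- r) F i) x = \sum_(i <- r) F i x.
Proof.
elim: r => [|i r ih]; first by rewrite !big_nil.
by rewrite !big_cons L2funDE ih.
Qed.

Lemma L2class_sum (I : Type) (r : seq I) (F : I -> L2fun mu) :
  L2class mu (\sum_(i <- r) F i) = \sum_(i <- r) L2class mu (F i).
Proof.
elim: r => [|i r ih]; first by rewrite !big_nil L2class0.
by rewrite !big_cons L2classD ih.
Qed.

Lemma L2class_ext (f g : L2fun mu) : (forall x, f x = g x) -> L2class mu f = L2class mu g.
Proof. by move=> fg; apply/L2class_eq; exact: aeW. Qed.

(** The representative equals the product at every point, so finite sums of products can be
    rearranged pointwise before passing to classes. *)
Lemma L2fun_mul_bounded (h : T -> R) (B : R) (f : L2fun mu) :
  0 <= B -> measurable_fun setT h -> (forall x, `|h x| <= B) ->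
  exists2 g : L2fun mu, (forall x, g x = real_complex R (h x) * f x) &
    hn (L2class mu g) <= B * hn (L2class mu f).
Proof.
move=> B0 mh hB.
have [mr mi] := measurable_L2fun f.
have mg : measurable_cfun (fun x => real_complex R (h x) * f x).
  by split; [under eq_fun do rewrite Re_realM|under eq_fun do rewrite Im_realM];
    exact: measurable_funM.
have Nle : (\int[mu]_x (normc (real_complex R (h x) * f x) ^+ 2)%:E <=
    ((B * hn (L2class mu f)) ^+ 2)%:E)%E.
  rewrite exprMn EFinM sqr_hnorm_L2class -ge0_integralZl//; first last.
  - by rewrite lee_fin sqr_ge0.
  - by move=> x _; rewrite lee_fin sqr_ge0.
  - exact: measurable_sqr_normc.
  apply: ge0_le_integral => //.
  - by move=> x _; rewrite lee_fin sqr_ge0.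
  - exact: measurable_sqr_normc.
  - apply: measurable_funeM; exact: measurable_sqr_normc.
  move=> x _; rewrite normcM normc_real_complex exprMn -EFinM lee_fin ler_wpM2r ?sqr_ge0//.
  by rewrite lerXn2r ?nnegrE// (le_trans (normr_ge0 _) (hB x)).
have sg : (fun x => real_complex R (h x) * f x) \in @sqint _ _ _ mu.
  apply/sqintP; have [m1 m2] := mg; split=> //.
  by rewrite (le_lt_trans Nle)// ltry.
exists (MkL2fun sg) => //.
rewrite -(@ler_pXn2r _ 2)// ?nnegrE ?hnorm_ge0 ?mulr_ge0 ?hnorm_ge0//.
by rewrite -lee_fin sqr_hnorm_L2class.
Qed.
End L2fun_operations.

(** * Norm estimate for multiplying an orthonormal sequence by small phases *)

Section phase_perturbation.
Context d (T : measurableType d) (R : realType) (mu : {measure set T -> \bar R}).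
Local Notation dot := (L2dot mu).
Local Notation hn := (hnorm (L2dot mu)).
Variables (m : nat) (X : 'I_m -> T -> R) (B : R).
Hypothesis B0 : 0 <= B.
Hypothesis mX : forall j, measurable_fun setT (X j).
Hypothesis XB : forall j x, `|X j x| <= B.
Variable e : nat -> L2fun mu.
Hypothesis eON : forall k l, dot (L2class mu (e k)) (L2class mu (e l)) = (k == l)%:R.
Variables (delta : nat -> 'I_m -> R) (L : R).
Hypothesis L0 : 0 <= L.
Hypothesis deltaL : forall k j, `|delta k j| <= L.

Let s k x := \sum_(j < m) delta k j * X j x.

Variable f : nat -> L2fun mu.
Hypothesis fE : forall k x, f k x = expi (s k x) * e k x.

Let K : R := m%:R * (B * L).

Let s_le k x : `|s k x| <= K.
Proof.
rewrite (le_trans (ler_norm_sum _ _ _))// (@le_trans _ _ (\sum_(j < m) (B * L)))//.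
  by apply: ler_sum => j _; rewrite normrM mulrC ler_pM.
by rewrite sumr_const card_ord -mulr_natl.
Qed.

Let ms k : measurable_fun setT (s k).
Proof. by apply: measurable_sum => j; exact: measurable_funM. Qed.

Let taylor_terms : exists E : nat -> nat -> L2fun mu,
  forall p k x, E p k x = expi_coeff (s k x) p * e k x.
Proof.
have H p k : exists g : L2fun mu, forall x, g x = expi_coeff (s k x) p * e k x.
  (* Only the real factor is a multiplier, bounded by [K ^ p / p!]; the power of [i] enters as a
     scalar. *)
  have [|||g gE _] := @L2fun_mul_bounded _ _ _ mu (fun x => s k x ^+ p / p`!%:R)
      (K ^+ p / p`!%:R) (e k).
  - by rewrite divr_ge0// exprn_ge0// !mulr_ge0.
  - by apply: measurable_funM => //; exact: measurable_funX.
  - by move=> x; rewrite normrM normrX (ger0_norm (x := _^-1))// ler_wpM2r// lerXn2r ?nnegrE// !mulr_ge0.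
  by exists (iC R ^+ p *: g) => x; rewrite L2funZE gE mulrA.
have H' p : exists E : nat -> L2fun mu, forall k x, E k x = expi_coeff (s k x) p * e k x.
  by have /choice[E EP] := H p; exists E.
by have /choice[E EP] := H'; exists E.
Qed.

Lemma phase_perturbation_le (c : nat -> R[i]) a b :
  hn (\sum_(a <= k < b) c k *: (L2class mu (f k) - L2class mu (e k))) <=
  (expR K - 1) * hn (\sum_(a <= k < b) c k *: L2class mu (e k)).
Proof.
have [E EE] := taylor_terms.
pose S0 (c : nat -> R[i]) := \sum_(a <= k < b) c k *: L2class mu (e k).
pose S p (c : nat -> R[i]) : L2fun mu := \sum_(a <= k < b) c k *: E p k.
have SE p c' x : S p c' x = \sum_(a <= k < b) c' k * (expi_coeff (s k x) p * e k x).
  by rewrite /S L2fun_sumE; apply: eq_bigr => k _; rewrite L2funZE EE.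
(* By orthonormality both norms are sums of squared coefficients, compared termwise. *)
have S0_delta c' j : hn (S0 (fun k => c' k * real_complex R (delta k j))) <= L * hn (S0 c').
  rewrite -(@ler_pXn2r _ 2)// ?nnegrE ?hnorm_ge0 ?mulr_ge0 ?hnorm_ge0//.
  rewrite exprMn !(sqr_hnorm_sum eON) mulr_sumr; apply: ler_sum => k _.
  rewrite normcM normc_real_complex exprMn mulrC ler_wpM2r ?sqr_ge0//.
  by rewrite lerXn2r ?nnegrE.
have S_le p : forall c', hn (L2class mu (S p c')) <= K ^+ p / p`!%:R * hn (S0 c').
  elim: p => [|p ih] c'.
    rewrite expr0 fact0 divr1 mul1r /S0 -(eq_bigr _ (fun k _ => L2classZ _ _)) -L2class_sum.
    rewrite (L2class_ext (g := \sum_(a <= k < b) c' k *: e k))// => x.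
    by rewrite SE L2fun_sumE; apply: eq_bigr => k _; rewrite L2funZE expi_coeff0 mul1r.
  pose c'' j k := c' k * real_complex R (delta k j).
  have /choice[g gP] : forall j, exists g : L2fun mu,
      (forall x, g x = real_complex R (X j x) * S p (c'' j) x) /\
      hn (L2class mu g) <= B * hn (L2class mu (S p (c'' j))).
    by move=> j; have [g] := L2fun_mul_bounded (S p (c'' j)) B0 (mX j) (XB j); exists g.
  (* [U_(p+1) c'] is [i / (p + 1)] times the sum over [j] of [X_j U_p c''_j]. Each of the [m]
     summands costs [B] for [X_j] and [L] for passing from [c'] to [c''_j], whence the factor
     [K = m B L]. *)
  rewrite (L2class_ext (g := (iC R * real_complex R p.+1%:R^-1) *: \sum_(j < m) g j)); last first.
    move=> x; rewrite SE L2funZE L2fun_sumE.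
    under [in RHS]eq_bigr do rewrite (gP _).1 SE mulr_sumr.
    rewrite exchange_big/= mulr_sumr; apply: eq_bigr => k _.
    rewrite expi_coeffS /s rmorph_sum/= !(mulr_suml, mulr_sumr); apply: eq_bigr => j _.
    by rewrite /c'' rmorphM/=; ring.
  rewrite L2classZ hnormZ normcM normc_real_complex ger0_norm//.
  have -> : normc (iC R) = 1 by rewrite /= expr0n/= expr1n add0r sqrtr1.
  rewrite mul1r L2class_sum exprS factS natrM invfM.
  rewrite [leRHS](_ : _ = p.+1%:R^-1 * (m%:R * (B * (K ^+ p / p`!%:R * (L * hn (S0 c')))))); last first.
    by rewrite {1}/K; ring.
  rewrite ler_wpM2l// (le_trans (ler_hnorm_sum _ _ _))//.
  rewrite mulr_natl -[in leRHS](card_ord m) -sumr_const; apply: ler_sum => j _.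
  rewrite (le_trans (gP j).2)// ler_wpM2l// (le_trans (ih _))//.
  rewrite ler_wpM2l//; last exact: S0_delta.
  by rewrite divr_ge0// exprn_ge0// !mulr_ge0.
pose F P : L2fun mu := \sum_(1 <= p < P.+1) S p c.
pose G : L2fun mu := \sum_(a <= k < b) c k *: (f k - e k).
have K0 : 0 <= K by rewrite !mulr_ge0.
have eK : 0 <= expR K - 1 by rewrite subr_ge0 -expR0 ler_expR.
have F_le P : hn (L2class mu (F P)) <= (expR K - 1) * hn (S0 c).
  rewrite L2class_sum (le_trans (ler_hnorm_sum _ _ _))//.
  rewrite (le_trans (ler_sum _ (fun p _ => S_le p c)))// -mulr_suml.
  by rewrite ler_wpM2r ?hnorm_ge0// sum_exp_coeff_le.
have -> : \sum_(a <= k < b) c k *: (L2class mu (f k) - L2class mu (e k)) = L2class mu G.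
  by rewrite L2class_sum; apply: eq_bigr => k _; rewrite L2classZ L2class_sub.
rewrite -(@ler_pXn2r _ 2)// ?nnegrE ?hnorm_ge0 ?mulr_ge0 ?hnorm_ge0//.
rewrite -lee_fin sqr_hnorm_L2class.
(* The bound on [F P] is uniform in [P], and for fixed [x] the finitely many Taylor series converge,
   so Fatou carries it to [G]. *)
apply: (fatou_sqr_normc (f := fun P => F P)).
- by move=> P; exact: measurable_L2fun.
- move=> x.
  have -> : G x = \sum_(a <= k < b) (c k * e k x) * (expi (s k x) - 1).
    rewrite /G L2fun_sumE; apply: eq_bigr => k _.
    by rewrite L2funZE L2funBE fE; ring.
  have -> : (fun P => F P x) = (fun P => \sum_(a <= k < b) (c k * e k x) *
      (\sum_(0 <= p < P.+1) expi_coeff (s k x) p - 1)).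
    apply/funext => P; rewrite /F L2fun_sumE.
    under eq_bigr do rewrite SE.
    rewrite exchange_big/=; apply: eq_bigr => k _.
    rewrite [in RHS]big_ltn// expi_coeff0 addrAC subrr add0r mulr_sumr; apply: eq_bigr => p _.
    by ring.
  apply: ccvg_sum => k; apply: ccvgMl; apply: ccvgB; last exact: ccvg_cst.
  (* [F P] includes the term [p = P], so it matches the partial sum of length [P.+1]. *)
  have := ccvg_shift 1 (cvg_expi_series (s k x)).
  by under [in X in X -> _]eq_fun do rewrite addn1.
move=> P; rewrite -sqr_hnorm_L2class lee_fin lerXn2r ?nnegrE ?hnorm_ge0 ?mulr_ge0 ?hnorm_ge0//.
Qed.

End phase_perturbation.

(** * Exponentials on the cube as phase multiples of one another *)

Section cube_phase.
Context (R : realType) (d : nat).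
Local Notation T := (measurableTypeR R).
Local Notation mu := (cube_measure R d).
Local Notation dot := (L2dot mu).

(* Cut off outside the cube so as to be a bounded multiplier on all of R^d; it
   agrees with the coordinate almost everywhere. *)
Definition cube_coord (j : 'I_d) (x : d.-tuple T) : R := \1_(cube R d) x * tnth x j.

Lemma measurable_cube_coord j : measurable_fun setT (cube_coord j).
Proof.
apply: measurable_funM; last exact: measurable_tnth.
by apply: measurable_indic; exact: measurable_cube.
Qed.

Lemma cube_coord_le j x : `|cube_coord j x| <= pi.
Proof.
rewrite /cube_coord indicE; case: (boolP (x \in cube R d)) => [|_].
  by rewrite inE mul1r => /(_ j); rewrite ler_norml.
by rewrite mul0r normr0 pi_ge0.
Qed.

Lemma ae_cube : {ae mu, forall x, cube R d x}.
Proof.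
exists (~` cube R d); split => //.
  by apply: measurableC; exact: measurable_cube.
by rewrite /= /cube_measure /mrestr setICl measure0.
Qed.

Lemma expiD (a b : R) : expi (a + b) = expi a * expi b.
Proof. by rewrite /expi cosD sinD; congr Complex; rewrite addrC. Qed.

Lemma exp_fun_phase (s t x : d.-tuple T) :
  exp_fun t x = expi (dotp x t - dotp x s) * exp_fun s x.
Proof. by rewrite /exp_fun mulrCA -expiD subrK. Qed.

(** With cut-off coordinates the phase agrees with [<x, t - s>] on the cube only; since the cube has
    full measure, this is enough for equality of classes. *)
Lemma exp_L2_phase (s t : d.-tuple T) : exists2 g : L2fun mu,
  forall x, g x = expi (\sum_(j < d) (tnth t j - tnth s j) * cube_coord j x) * exp_L2fun s x
  & L2class mu g = exp_L2 t.
Proof.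
pose w x := \sum_(j < d) (tnth t j - tnth s j) * cube_coord j x.
have mw : measurable_fun setT w.
  by apply: measurable_sum => j; apply: measurable_funM => //; exact: measurable_cube_coord.
(* The multiplier lemma takes real factors, so [exp (i w)] is assembled as [cos w + i sin w]. *)
have [|||gc gcE _] := @L2fun_mul_bounded _ _ _ mu (fun x => cos (w x)) 1 (exp_L2fun s) => //.
- by apply: measurableT_comp mw; exact: continuous_measurable_fun (@continuous_cos R).
- by move=> x; exact: ler_norm_cos.
have [|||gs gsE _] := @L2fun_mul_bounded _ _ _ mu (fun x => sin (w x)) 1 (exp_L2fun s) => //.
- by apply: measurableT_comp mw; exact: continuous_measurable_fun (@continuous_sin R).
- by move=> x; rewrite -cosBpihalf; exact: ler_norm_cos.
have gE x : (gc + iC R *: gs) x = expi (w x) * exp_L2fun s x.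
  rewrite L2funDE L2funZE gcE gsE [iC R * _]mulrA -mulrDl; congr (_ * _).
  by rewrite /expi /iC; congr Complex => /=; ring.
exists (gc + iC R *: gs) => //.
apply/L2class_eq; apply: filterS ae_cube => x cx; rewrite gE /= [RHS](exp_fun_phase s).
congr (expi _ * _); rewrite /w /dotp -sumrB; apply: eq_bigr => j _.
by rewrite /cube_coord indicE mem_set// mul1r mulrC mulrBr.
Qed.

End cube_phase.

Theorem corollary6p1 (R : realType) (d : nat)
    (n : nat -> d.-tuple int) (t : nat -> d.-tuple R) (L : R) :
  bijective n ->
  ereal_sup (range (fun k =>
    (linf_dist [tuple (tnth (n k) i)%:~R | i < d] (t k))%:E)) = L%:E ->
  L < ln 2 / (pi * d%:R) ->
  riesz_basis (L2dot (cube_measure R d)) (fun k => exp_L2 (t k)).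
Proof.
move=> bijn supL Llt.
have [d0|d0] := posnP d.
  (* There is a single tuple of length 0, so [n] could not be injective on the naturals. *)
  have [g nK _] := bijn; suff : 0%N = 1%N by [].
  by apply: (can_inj nK); apply: eq_from_tnth => i; have := ltn_ord i; rewrite {2}d0.
pose delta k (j : 'I_d) : R := tnth (t k) j - tnth (freq R (n k)) j.
have deltaL k j : `|delta k j| <= L.
  have : linf_dist (freq R (n k)) (t k) <= L.
    by rewrite -lee_fin -supL; apply: ereal_sup_ubound; exists k.
  apply: le_trans; rewrite /linf_dist /delta distrC.
  exact: (le_bigmax _ (fun i => `|tnth (freq R (n k)) i - tnth (t k) i|)).
(* [d > 0] supplies a coordinate at which [L] bounds an absolute value. *)
have L0 : 0 <= L := le_trans (normr_ge0 _) (deltaL 0%N (Ordinal d0)).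
have pi0 : 0 <= pi :> R by exact: pi_ge0.
have eON k l : L2dot (cube_measure R d) (L2class _ (exp_L2fun (freq R (n k))))
    (L2class _ (exp_L2fun (freq R (n l)))) = (k == l)%:R.
  by rewrite [LHS]exp_L2_orthonormal (bij_eq bijn).
have /choice[f fP] : forall k, exists g : L2fun (cube_measure R d),
    (forall x, g x = expi (\sum_(j < d) delta k j * cube_coord j x)
      * exp_L2fun (freq R (n k)) x) /\ L2class _ g = exp_L2 (t k).
  by move=> k; have [g] := exp_L2_phase (freq R (n k)) (t k); exists g.
pose K : R := d%:R * (pi * L).
have Kln2 : K < ln 2.
  move: Llt; rewrite ltr_pdivlMr ?mulr_gt0 ?pi_gt0 ?ltr0n// /K.
  by rewrite (_ : L * _ = d%:R * (pi * L)); [|ring].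
have K0 : 0 <= K by rewrite !mulr_ge0.
apply: (@riesz_basis_perturbation _ _ _ (fun k => exp_L2 (freq R (n k))) _ _ _ _ (expR K - 1)).
- exact: eON.
- exact: L2_complete.
(* Surjectivity of [n] turns orthogonality along the enumeration into orthogonality to every integer
   frequency. *)
- move=> u uorth; rewrite -[u]L2classK; apply: exp_L2_total => k.
  have [g _ gK] := bijn; rewrite -(gK k) L2classK; exact: uorth.
(* [exp K - 1 < 1] amounts to [exp K < 2 = exp (ln 2)], which is [Kln2]. *)
- rewrite subr_ge0 -{1}expR0 ler_expR K0/= ltrBlDr -[1 + 1]/(2 : R).
  by rewrite -(@lnK R 2) ?posrE// ltr_expR.
- move=> c a b; under eq_bigr do rewrite -(fP _).2.
  exact: (phase_perturbation_le pi0 (@measurable_cube_coord R d)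
    (@cube_coord_le R d) eON L0 deltaL (fun k => (fP k).1)).
Qed.
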